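(* Let $n\geq 2$ be an even integer. There is a constant $c_n$, depending only on $n$, such that the following holds. Let $\mathbb{F}_q$ be a finite field with $q$ odd, let $C$ and $D$ be distinct smooth quadrics in $\mathbb{P}^n$ over $\mathbb{F}_q$, and let $\sigma=\dim(C\cap D)_{\mathrm{sing}}$. Then the number of points $\underline{x}\in\mathbb{P}^n(\mathbb{F}_q)$ external to $C$ but internal to $D$ equals \[\frac{q^n-q^{n-1}}{4}+O\left(q^{(n+\sigma+1)/2}\right),\] where the error term is bounded in absolute value by $c_n\,q^{(n+\sigma+1)/2}$.
   Context: Convention: $\dim\emptyset=-1$. Writing $C=\{f_1=0\}$ and $D=\{f_2=0\}$, the singular locus $(C\cap D)_{\mathrm{sing}}$ of the scheme-theoretic intersection is the set of points $\underline{x}\in C\cap D$ (over $\overline{\mathbb{F}_q}$) at which the Jacobian matrix of $(f_1,f_2)$ has rank less than $2$. Let $n$ be even, $q$ odd, and let $C=\{f=0\}\subset\mathbb{P}^n$ be a smooth quadric over $\mathbb{F}_q$ ($f$ a nondegenerate quadratic form in $n+1$ variables). Let $P\in\mathbb{P}^n(\mathbb{F}_q)$ be a point not on $C$, and let $P^\perp$ be its polar hyperplane with respect to $C$ (the hyperplane orthogonal to $P$ under the symmetric bilinear form associated with $f$). Then $C\cap P^\perp$ is a smooth quadric in $P^\perp\cong\mathbb{P}^{n-1}$, with $n-1$ odd, hence is either hyperbolic (the restricted form is an orthogonal sum of hyperbolic planes) or elliptic (otherwise). The point $P$ is called external to $C$ if $C\cap P^\perp$ is hyperbolic, and internal to $C$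 if $C\cap P^\perp$ is elliptic. For $n=2$ (conics), $P$ is external if there are two $\mathbb{F}_q$-tangent lines to $C$ through $P$ and internal if there are none. *)

(* Defs.v *)
From HB Require Import structures.
From mathcomp Require Import all_boot all_order all_algebra.
From mathcomp Require Import mpoly.
From mathcomp Require Import reals.

Set Implicit Arguments.
Unset Strict Implicit.
Unset Printing Implicit Defensive.

Import Order.TTheory GRing.Theory Num.Theory.
Local Open Scope ring_scope.

Definition evalv (R : comNzRingType) (n : nat) (f : {mpoly R[n]}) (x : 'rV[R]_n) : R :=
  f.@[fun i => x 0 i].

(* No factor 1/2: polar f x x = 2 f(x) for a quadratic form f. *)
Definition polar (R : comNzRingType) (n : nat) (f : {mpoly R[n]}) (x y : 'rV[R]_n) : R :=
  evalv f (x + y) - evalv f x - evalv f y.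

Definition nondegenerate (R : comNzRingType) (n : nat) (f : {mpoly R[n]}) : Prop :=
  forall x : 'rV[R]_n, (forall y : 'rV[R]_n, polar f x y = 0) -> x = 0.

(* In odd characteristic the quadric {f = 0} is smooth exactly when f is
   nondegenerate; this is the meaning given to smoothness here. *)
Definition smooth_quadric (R : comNzRingType) (n : nat) (f : {mpoly R[n]}) : Prop :=
  f \is 2.-homog /\ nondegenerate f.

(* Linear subspaces of F^N are row spaces of N x N matrices (scope %MS); the
   projective point of a nonzero row vector x is the canonical matrix <<x>>%MS
   of its span, so that <<x>>%MS = <<y>>%MS iff x and y are proportional. *)
Section FiniteField.
Variables (F : finFieldType) (N : nat).
Implicit Types (f : {mpoly F[N]}) (x u v : 'rV[F]_N) (U W : 'M[F]_N).

Definition perp f x : 'M[F]_N := (\sum_(y : 'rV[F]_N | polar f x y == 0%R) <<y>>)%MS.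

Definition hyperbolic_plane f U : bool :=
  [exists u : 'rV[F]_N, [exists v : 'rV[F]_N,
    [&& evalv f u == 0, evalv f v == 0, polar f u v == 1,
        \rank U == 2 & (U == u + v)%MS]]].

Definition orthogonal_spaces f U W : bool :=
  [forall u : 'rV[F]_N, forall v : 'rV[F]_N,
    ((u <= U)%MS && (v <= W)%MS) ==> (polar f u v == 0)].

(* f restricted to W is an orthogonal sum of hyperbolic planes; their number
   can only be half of the dimension of W. *)
Definition hyperbolic f W : bool :=
  [exists U : {ffun 'I_(\rank W)./2 -> 'M[F]_N},
    [&& [forall i, hyperbolic_plane f (U i)],
        [forall i, forall j, (i != j) ==> orthogonal_spaces f (U i) (U j)],
        mxdirect (\sum_i U i)%MS & (\sum_i U i == W)%MS]].

Definition elliptic f W : bool := ~~ hyperbolic f W.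

Definition external f x : bool :=
  [&& x != 0, evalv f x != 0 & hyperbolic f (perp f x)].

Definition internal f x : bool :=
  [&& x != 0, evalv f x != 0 & elliptic f (perp f x)].

Definition external_internal_points f1 f2 : {set 'M[F]_N} :=
  [set <<x>>%MS | x : 'rV[F]_N & external f1 x && internal f2 x].

End FiniteField.

(* A subset of projective space over K is a predicate on coordinate vectors.
   The sets considered below (quadrics, singular loci, Zariski closed sets)
   consist of nonzero vectors and are stable under nonzero scalars. *)
Section Projective.
Variables (K : fieldType) (N : nat).
Implicit Types (X Y Z A B : 'rV[K]_N -> Prop).

Definition subsetP X Y : Prop := forall x, X x -> Y x.

Definition zariski_closed Z : Prop :=
  exists I : {mpoly K[N]} -> Prop,
    (forall p, I p -> exists d : nat, p \is d.-homog) /\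
    (forall x, Z x <-> x != 0 /\ forall p, I p -> evalv p x = 0).

Definition zariski_irreducible Z : Prop :=
  (exists x, Z x) /\
  forall A B, zariski_closed A -> zariski_closed B ->
    (forall x, Z x -> A x \/ B x) -> subsetP Z A \/ subsetP Z B.

Definition irreducible_chain X (d : nat) : Prop :=
  exists Z : nat -> ('rV[K]_N -> Prop),
    (forall i, (i <= d)%N ->
      [/\ zariski_closed (Z i), zariski_irreducible (Z i) & subsetP (Z i) X]) /\
    (forall i, (i < d)%N -> subsetP (Z i) (Z i.+1) /\ ~ subsetP (Z i.+1) (Z i)).

(* Krull dimension of a Zariski closed set; the empty set has dimension -1. *)
Definition is_dim X (s : int) : Prop :=
  -1 <= s /\ forall d : nat, irreducible_chain X d <-> d%:Z <= s.

Definition quadric (f : {mpoly K[N]}) : 'rV[K]_N -> Prop :=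
  fun x => x != 0 /\ evalv f x = 0.

Definition jacobian (f1 f2 : {mpoly K[N]}) (x : 'rV[K]_N) : 'M[K]_(2, N) :=
  \matrix_(i < 2, j < N) evalv ((if i == 0 then f1 else f2)^`M(j)) x.

Definition sing_locus (f1 f2 : {mpoly K[N]}) : 'rV[K]_N -> Prop :=
  fun x => [/\ quadric f1 x, quadric f2 x & (\rank (jacobian f1 f2 x) < 2)%N].

End Projective.

(* Main.v *)
Require Import Defs.
From mathcomp Require Import all_boot all_order all_algebra.
From mathcomp Require Import mpoly.
From mathcomp Require Import reals.
From mathcomp Require Import boolp ring lra zify fingroup cyclic mxabelem.

Set Implicit Arguments.
Unset Strict Implicit.
Unset Printing Implicit Defensive.

Import Order.TTheory GRing.Theory Num.Theory.
Local Open Scope ring_scope.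

(** Write N = n + 1 = 2m + 1 and let f1, f2 be the two forms, with symmetric
    matrices A1, A2. Everything rests on representation numbers of quadratic
    forms over F, of order q.

    Externality is a quadratic character. A nondegenerate form of rank 2m is
    hyperbolic or elliptic, and this shows in its number of zeros. When
    f(x) != 0, the space is the orthogonal sum of the line of x and its polar;
    comparing the representation numbers of f and of its restriction to the
    polar shows that x is external exactly when delta chi (f x) = 1, for a sign
    delta depending on f only ([external_chi]). The same comparison shows that
    a nondegenerate form in N variables has exactly q^(N-1) zeros.

    The count is a combination of pencil sums. Four times the number of vectors
    external for f1 and internal for f2 is the sum of
    (chi(f1)^2 + delta1 chi(f1)) (chi(f2)^2 - delta2 chi(f2)). The sums that
    arise by expanding this are the number of points off both quadrics, sums of
    one character off or on the other quadric, and the sum of chi (f1 f2).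
    Sorting the points by the value l of f2 / f1, that is by the member
    f2 - l f1 of the pencil containing them, expresses the number of common
    zeros and the sum of chi (f1 f2) through the deviations of the numbers of
    zeros of the members from q^(N-1), and the sum of chi (f2) on the first
    quadric through the sums of chi over the members ([sum_base_count],
    [sum_chi_mul], [sum_chi_base]). The deviations vanish for nondegenerate
    members, and at most N members are degenerate. This vanishing is what saves
    a factor of the square root of q when the intersection is smooth.

    The size of the contribution of a member is governed by its corank e: the
    second moment of the representation numbers, which only counts orthogonal
    pairs of vectors ([sum_dev_sq]), bounds the deviations by q^((N + e) / 2)
    and the character sums by q^((N + e - 1) / 2) times q - 1.

    Coranks are bounded by sigma + 2. If the member f2 - l f1 has a kernel E of
    dimension e, then over the algebraic closure all zeros of f1 in E are
    singular points of the intersection; they form a quadric in a projective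
    space of dimension e - 1, of dimension at least e - 2. An explicit
    parametrisation of part of this quadric yields the required chain of
    irreducible closed sets ([quadric_chain], [sing_locus_chain]). *)

(** * Symmetric bilinear forms given by matrices *)

Section Bilinear.
Variables (K : fieldType) (N : nat).
Implicit Types (A W : 'M[K]_N) (x y z u v : 'rV[K]_N) (a b : K).

Definition bil A x y : K := (x *m A *m y^T) 0 0.
Definition qf A x : K := bil A x x.

Lemma bilDl A x y z : bil A (x + y) z = bil A x z + bil A y z.
Proof. by rewrite /bil !mulmxDl mxE. Qed.
Lemma bilDr A x y z : bil A x (y + z) = bil A x y + bil A x z.
Proof. by rewrite /bil linearD mulmxDr mxE. Qed.
Lemma bilZl A a x y : bil A (a *: x) y = a * bil A x y.
Proof. by rewrite /bil -!scalemxAl mxE. Qed.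
Lemma bilZr A a x y : bil A x (a *: y) = a * bil A x y.
Proof. by rewrite /bil linearZ -scalemxAr mxE. Qed.
Lemma bilNl A x y : bil A (- x) y = - bil A x y.
Proof. by rewrite /bil !mulNmx mxE. Qed.
Lemma bilNr A x y : bil A x (- y) = - bil A x y.
Proof. by rewrite /bil linearN mulmxN mxE. Qed.
Lemma bil0l A x : bil A 0 x = 0.
Proof. by rewrite /bil !mul0mx mxE. Qed.
Lemma bil0r A x : bil A x 0 = 0.
Proof. by rewrite /bil trmx0 mulmx0 mxE. Qed.
Lemma bilBA A1 A2 a x y : bil (A2 - a *: A1) x y = bil A2 x y - a * bil A1 x y.
Proof.
by rewrite /bil mulmxBr mulmxBl -scalemxAr -scalemxAl !mxE.
Qed.
Lemma qfBA A1 A2 a x : qf (A2 - a *: A1) x = qf A2 x - a * qf A1 x.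
Proof. exact: bilBA. Qed.

Lemma bilC A x y : A^T = A -> bil A x y = bil A y x.
Proof.
move=> sA; rewrite /bil.
have -> : (x *m A *m y^T) = (y *m A *m x^T)^T.
  by rewrite !trmx_mul trmxK sA mulmxA.
by rewrite mxE.
Qed.

Definition bilE := (bilDl, bilDr, bilZl, bilZr, bilNl, bilNr).

Lemma qfZ A a x : qf A (a *: x) = a ^+ 2 * qf A x.
Proof. by rewrite /qf !bilE; ring. Qed.

Lemma qfD A x y : A^T = A -> qf A (x + y) = qf A x + 2 * bil A x y + qf A y.
Proof. by move=> sA; rewrite /qf !bilE (bilC y x sA); ring. Qed.

Lemma bil_delta A x j : bil A x (delta_mx 0 j) = (x *m A) 0 j.
Proof.
rewrite /bil trmx_delta; set M := x *m A.
rewrite mxE (bigD1 j) //= big1 ?addr0 => [|k /negbTE nkj]; rewrite !mxE ?nkj ?mulr0 //.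
by rewrite !eqxx mulr1.
Qed.

Lemma bil_eq0 A x : (forall y, bil A x y = 0) -> x *m A = 0.
Proof.
by move=> h; apply/rowP => j; rewrite -bil_delta h mxE.
Qed.

Definition orth A x : 'M[K]_N := kermx (A *m x^T).

Lemma orthP A x w : (w <= orth A x)%MS = (bil A w x == 0).
Proof.
rewrite /orth; rewrite /bil -mulmxA; apply/sub_kermxP/eqP => [->|h]; first by rewrite mxE.
by apply/matrixP => i j; rewrite !ord1 h mxE.
Qed.

(** W A x^T is a column, so its rank is 0 or 1: passing to the orthogonal of x
    lowers the dimension of W by one unless x is orthogonal to all of W. *)
Lemma rank_orth A W x : (\rank (W :&: orth A x)%MS + (W *m (A *m x^T) != 0)%R = \rank W)%N.
Proof.
rewrite -(mxrank_mul_ker W (A *m x^T)) addnC; congr (_ + _)%N.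
have := rank_leq_col (W *m (A *m x^T)).
by rewrite -mxrank_eq0; case: (\rank _) => [|[|]].
Qed.

Definition nondeg A W := forall w, (w <= W)%MS ->
  (forall w', (w' <= W)%MS -> bil A w w' = 0) -> w = 0.

Lemma row_mulmx_bil A W x : (W *m (A *m x^T) == 0) = [forall i, bil A (row i W) x == 0].
Proof.
apply/eqP/forallP => [h i|h].
  by apply/eqP; rewrite /bil -mulmxA -row_mul h !mxE.
apply/matrixP => i j; rewrite ord1 !mxE; have /eqP := h i.
by rewrite /bil -mulmxA -row_mul mxE mxE.
Qed.

Lemma mulmx_bil0 A W x :
  reflect (forall w, (w <= W)%MS -> bil A w x = 0) (W *m (A *m x^T) == 0).
Proof.
apply: (iffP eqP) => [h w /submxP[D ->]|h].
  by rewrite /bil -!mulmxA h mulmx0 mxE.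
by apply/eqP; rewrite row_mulmx_bil; apply/forallP => i; apply/eqP/h/row_sub.
Qed.

Lemma addsmx_rowP W x w :
  reflect (exists c : K, (w - c *: x <= W)%MS) (w <= x + W)%MS.
Proof.
apply: (iffP sub_addsmxP) => [[[u v] /= ->]|[c h]].
  exists (u 0 0).
  by rewrite [u]mx11_scalar mul_scalar_mx mxE eqxx mulr1n addrC addKr submxMl.
by have /submxP[D hD] := h; exists (c%:M, D); rewrite mul_scalar_mx /= -hD addrC subrK.
Qed.

(** On the line w + K u the form is affine in the parameter, hence has a zero
    there; rescaling it gives v, normalised so that the polar form, which is
    twice b, takes the value 1 on (u, v). *)
Lemma isotropic_partner A W u w : A^T = A -> (2 : K) != 0 ->
  (u <= W)%MS -> (w <= W)%MS -> qf A u = 0 -> bil A u w != 0 ->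
  exists v, [/\ (v <= W)%MS, qf A v = 0 & bil A u v = 2^-1].
Proof.
move=> sA two0 uW wW qu b0.
exists ((2 * bil A u w)^-1 *: (w - (qf A w / (2 * bil A u w)) *: u)); split.
- by rewrite scalemx_sub // addmx_sub // eqmx_opp scalemx_sub.
- by rewrite /qf !bilE (bilC w u sA) -!/(qf A _) qu; field; apply/andP.
by rewrite !bilE -/(qf A u) qu; field; apply/andP.
Qed.

End Bilinear.

Arguments bilE {K N}.

(** * Quadratic character *)

Section QuadraticCharacter.
Variables (R : realFieldType) (F : finFieldType).
Hypothesis q_odd : odd #|F|.
Implicit Types (s t a b c : F).

Local Notation q := (#|F|%:R : R).

(** In characteristic 2 an odd multiple of 1 is 1, but the order of F kills 1. *)
Lemma two_neq0 : (2 : F) != 0.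
Proof.
apply/negP => /eqP h2.
have := @expg_cardG _ [set: F]%G (1%R : F) (in_setT _); rewrite FinRing.zmodXgE cardsT.
rewrite FinRing.zmod1gE -[#|F|]odd_double_half q_odd mulrnDr -mul2n mulrnA.
by rewrite -[1 *+ 2]/(2 : F) h2 mul0rn addr0 => /eqP; rewrite oner_eq0.
Qed.

Definition chi s : R :=
  if s == 0 then 0 else if [exists c : F, c ^+ 2 == s] then 1 else -1.

Lemma chi0 : chi 0 = 0. Proof. by rewrite /chi eqxx. Qed.

Lemma chi_sqr s : chi s ^+ 2 = (s != 0)%:R.
Proof. by rewrite /chi; case: (s == 0) => /=; [ring | case: ifP => _; ring]. Qed.

Lemma chi_pm1 s : s != 0 -> chi s = 1 \/ chi s = -1.
Proof. by rewrite /chi => /negbTE->; case: ifP; [left|right]. Qed.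

Lemma card_sqrt s : \sum_c (c ^+ 2 == s)%:R = 1 + chi s.
Proof.
rewrite /chi; have [->|s0] := eqVneq s 0.
  rewrite addr0 (bigD1 0) //= big1 ?addr0 ?expr0n ?eqxx // => c /negbTE c0.
  by rewrite sqrf_eq0 c0.
case: ifPn => [/existsP[c /eqP hc]|/existsPn hs]; last first.
  by rewrite big1 ?subrr // => c _; rewrite (negbTE (hs c)).
have c0 : c != 0 by apply: contraNneq s0 => c0; rewrite -hc c0 expr0n.
have cN : - c != c.
  rewrite -subr_eq0 -opprD oppr_eq0 -mulr2n -mulr_natr mulf_eq0 (negbTE c0).
  exact: two_neq0.
rewrite (bigD1 c) //= (bigD1 (- c)) //= big1 ?addr0.
  by rewrite sqrrN hc eqxx.
by move=> d /andP[dc dNc]; rewrite -hc eqf_sqr (negbTE dc) (negbTE dNc).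
Qed.

Lemma sum_ind (T : finType) (h : T -> R) (x : T) : \sum_t h t * (x == t)%:R = h x.
Proof.
rewrite (bigD1 x) //= eqxx mulr1 big1 ?addr0 // => t tx.
by rewrite eq_sym (negbTE tx) mulr0.
Qed.

Lemma sum_ind1 (T : finType) (x : T) : \sum_t (x == t)%:R = 1 :> R.
Proof.
by rewrite -[RHS](sum_ind (fun=> 1) x); apply: eq_bigr => t _; rewrite mul1r.
Qed.

Lemma sum_chi : \sum_s chi s = 0.
Proof.
have : \sum_(s : F) (1 + chi s) = q.
  rewrite -(eq_bigr _ (fun s _ => card_sqrt s)) exchange_big /=.
  by rewrite (eq_bigr (fun=> 1)) ?sumr_const // => c _; rewrite sum_ind1.
rewrite big_split /= sumr_const => /eqP.
by rewrite -subr_eq0 addrAC subrr add0r => /eqP.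
Qed.

Lemma chi_mulsq a s : a != 0 -> chi (a ^+ 2 * s) = chi s.
Proof.
move=> a0; rewrite /chi mulf_eq0 sqrf_eq0 (negbTE a0) /=; case: ifP => // s0.
suff -> : [exists c, c ^+ 2 == a ^+ 2 * s] = [exists c, c ^+ 2 == s] by [].
apply/existsP/existsP => -[c /eqP hc].
  by exists (c / a); rewrite exprMn exprVn hc mulrAC divff ?mul1r // sqrf_eq0.
by exists (a * c); rewrite exprMn hc.
Qed.

(** Multiplicativity says that a product of two non-squares is a square. For a
    non-square s no term of the sum of chi (s t) + chi t is positive; since the
    sum vanishes, so does every term. *)
Lemma chiM s t : chi (s * t) = chi s * chi t.
Proof.
have [->|s0] := eqVneq s 0; first by rewrite !(mul0r, chi0).
have chi1 c : c != 0 -> chi (c ^+ 2) = 1.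
  move=> c0; rewrite /chi sqrf_eq0 (negbTE c0).
  by case: ifPn => // /existsPn/(_ c); rewrite eqxx.
have sqP c : chi c = 1 -> exists2 d, d != 0 & c = d ^+ 2.
  rewrite /chi; case: eqVneq => [_ /eqP|c0]; first by rewrite eq_sym oner_eq0.
  case: ifP => [/existsP[d /eqP hd] _|_ h]; last by exfalso; lra.
  by exists d => //; apply: contraNneq c0 => d0; rewrite -hd d0 expr0n.
have [chis|chis] := chi_pm1 s0.
  by have [d d0 ->] := sqP _ chis; rewrite chi_mulsq // chi1 // mul1r.
have le0 u : 0 <= - (chi (s * u) + chi u).
  have [->|u0] := eqVneq u 0; first by rewrite mulr0 chi0 addr0 oppr0.
  have [chiu|->] := chi_pm1 u0.
    by have [d d0 ->] := sqP _ chiu; rewrite chi1 // mulrC chi_mulsq // chis; lra.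
  have su0 : s * u != 0 by rewrite mulf_neq0.
  by have [->|->] := chi_pm1 su0; lra.
have : \sum_u (- (chi (s * u) + chi u)) = 0.
  rewrite sumrN big_split /= sum_chi addr0.
  have bij : {on [pred i | true], bijective (fun u : F => s * u)}.
    by exists (fun u => s^-1 * u) => u _; rewrite (mulKf s0, mulVKf s0).
  by move: sum_chi; rewrite (reindex _ bij) /= => ->; rewrite oppr0.
move=> h0; have {h0} := (psumr_eq0P (fun u _ => le0 u) h0) t isT.
by rewrite chis => h; lra.
Qed.

End QuadraticCharacter.

(** * Representation numbers of quadratic forms on subspaces *)

Definition qcard (R : realFieldType) (F : finFieldType) : R := #|F|%:R.

Section Counting.
Variables (R : realFieldType) (F : finFieldType) (N : nat).
Hypothesis q_odd : odd #|F|.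
Implicit Types (s t a b c : F) (A W : 'M[F]_N) (x y u v w : 'rV[F]_N).

Local Notation q := (qcard R F).

Lemma q_gt2 : 2 < q.
Proof.
rewrite /qcard ltr_nat; have := card_finRing_gt1 F.
by case: #|F| q_odd => [|[|[|]]].
Qed.

Lemma q_gt0 : 0 < q.
Proof. by apply: lt_trans q_gt2. Qed.

Lemma q_sub1_gt0 : 0 < q - 1.
Proof. by rewrite subr_gt0; apply: lt_trans q_gt2; rewrite ltr1n. Qed.

Lemma sum1_sub W : \sum_(w : 'rV[F]_N | (w <= W)%MS) 1 = q ^+ \rank W :> R.
Proof.
rewrite /qcard -natrX -card_rowg -sum1_card natr_sum; apply: eq_bigl => w.
by rewrite inE.
Qed.

Lemma sum_sub_shift W u (h : 'rV[F]_N -> R) : (u <= W)%MS ->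
  \sum_(w | (w <= W)%MS) h w = \sum_(w | (w <= W)%MS) h (w + u).
Proof.
move=> uW; rewrite (reindex_inj (addIr u)) /=; apply: eq_bigl => w.
apply/idP/idP => h1; last exact: addmx_sub.
by rewrite -[w](addrK u) addmx_sub // eqmx_opp.
Qed.

Lemma sum_sub_scale W a (h : 'rV[F]_N -> R) : a != 0 ->
  \sum_(w | (w <= W)%MS) h w = \sum_(w | (w <= W)%MS) h (a *: w).
Proof.
move=> a0; rewrite (reindex_inj (scalerI a0)) /=; apply: eq_bigl => w.
by rewrite (eqmx_scale w a0).
Qed.

Lemma sum_sub_adds W x (h : 'rV[F]_N -> R) : ~~ (x <= W)%MS ->
  \sum_(w | (w <= x + W)%MS) h w = \sum_c \sum_(w | (w <= W)%MS) h (c *: x + w).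
Proof.
move=> xW; rewrite pair_big_dep /=.
rewrite (reindex_onto (fun p : F * 'rV[F]_N => p.1 *: x + p.2)
  (fun w => let c := odflt 0 [pick c : F | (w - c *: x <= W)%MS] in (c, w - c *: x))) /=.
  apply: eq_bigl => -[c w] /=; apply/andP/idP => [[hw /eqP[]]|wW].
    case: pickP => [d hd|hd] /= e1 e2; first by rewrite e2 in hd.
    by case/addsmx_rowP: hw => d; rewrite hd.
  have hx : ((c *: x + w)%R <= x + W)%MS.
    by apply/addsmx_rowP; exists c; rewrite addrAC subrr add0r.
  split=> //; case: pickP => [d|/(_ c)] /=; last first.
    by rewrite addrAC subrr add0r wW.
  move=> hd; suff -> : d = c by rewrite addrAC subrr add0r eqxx.
  apply/eqP; apply: contraNT xW => dc; rewrite -(eqmx_scale x (a := c - d)).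
    have -> : (c - d) *: x = (c *: x + w - d *: x) - w.
      by apply/rowP => j; rewrite !mxE; ring.
    by rewrite addmx_sub // eqmx_opp.
  by rewrite subr_eq0 eq_sym.
by move=> w _; rewrite addrC subrK.
Qed.

Definition cnt A W t : R := \sum_(w | (w <= W)%MS) (qf A w == t)%:R.

Lemma sum_cnt_mul A W (h : F -> R) :
  \sum_t h t * cnt A W t = \sum_(w | (w <= W)%MS) h (qf A w).
Proof.
under eq_bigr do rewrite mulr_sumr.
by rewrite exchange_big /=; apply: eq_bigr => w _; rewrite sum_ind.
Qed.

Lemma sum_cnt A W : \sum_t cnt A W t = q ^+ \rank W.
Proof.
by rewrite -sum1_sub -(sum_cnt_mul A W (fun=> 1)); apply: eq_bigr => t _; rewrite mul1r.
Qed.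

(** W A u^T vanishes exactly when u is orthogonal to W, so for u in W this is
    the number of vectors in the radical of the form on W. *)
Definition rad A W : R :=
  \sum_(u : 'rV[F]_N | (u <= W)%MS) (W *m (A *m u^T) == 0)%:R.

Lemma sum_orth A W u :
  q * \sum_(v | (v <= W)%MS) (bil A v u == 0)%:R =
  q ^+ \rank W * (1 + (q - 1) * (W *m (A *m u^T) == 0)%:R).
Proof.
have -> : \sum_(v | (v <= W)%MS) (bil A v u == 0)%:R =
          \sum_(v : 'rV[F]_N | (v <= W :&: orth A u)%MS) 1 :> R.
  rewrite [RHS](eq_bigl (fun v => (v <= W)%MS && (bil A v u == 0))); last first.
    by move=> v; rewrite sub_capmx orthP.
  by rewrite [RHS]big_mkcondr /=; apply: eq_bigr => v _; case: (_ == 0).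
rewrite sum1_sub -(rank_orth A W u).
move: (\rank (W :&: orth A u)%MS) => r.
case: (_ == 0); rewrite /=; first by rewrite addn0; ring.
by rewrite addn1 exprS; ring.
Qed.

(** The second moment counts the pairs x, y in W on which the form takes equal
    values. With u = x - y and v = x + y the difference of these values is
    b(u, v), so it counts orthogonal pairs instead, and these are counted by
    dimension. *)
Lemma sum_cnt_sq A W : A^T = A ->
  q * \sum_t cnt A W t ^+ 2 =
  q ^+ \rank W * (q ^+ \rank W + (q - 1) * rad A W).
Proof.
move=> sA; have two0 := two_neq0 q_odd.
have -> : \sum_t cnt A W t ^+ 2 = \sum_(x | (x <= W)%MS) \sum_(y | (y <= W)%MS)
   (qf A x == qf A y)%:R.
  under eq_bigr do rewrite expr2.
  by rewrite sum_cnt_mul; apply: eq_bigr => x _; apply: eq_bigr => y _; rewrite eq_sym.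
have -> : \sum_(x | (x <= W)%MS) \sum_(y | (y <= W)%MS) (qf A x == qf A y)%:R =
   \sum_(u | (u <= W)%MS) \sum_(v | (v <= W)%MS) (bil A v u == 0)%:R :> R.
  transitivity (\sum_(x | (x <= W)%MS) \sum_(u | (u <= W)%MS)
    (2 * bil A x u + qf A u == 0)%:R : R).
    apply: eq_bigr => x xW; rewrite (sum_sub_shift _ xW); apply: eq_bigr => u _.
    congr (_%:R); rewrite [u + x]addrC qfD // -subr_eq0; congr (nat_of_bool _).
    by rewrite -oppr_eq0; congr (_ == 0); ring.
  rewrite exchange_big /=; apply: eq_bigr => u uW.
  have h2 : (2^-1 : F) != 0 by rewrite invr_eq0.
  have uW2 : (- u <= W)%MS by rewrite eqmx_opp.
  rewrite (sum_sub_scale _ _ h2) (sum_sub_shift _ uW2); apply: eq_bigr => v _.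
  congr (_%:R); congr (nat_of_bool _); congr (_ == 0).
  by rewrite /qf !bilE; field.
rewrite mulr_sumr; under eq_bigr do rewrite sum_orth.
by rewrite -mulr_sumr big_split /= sum1_sub -mulr_sumr -/(rad A W); ring.
Qed.

(** The variance form of the second moment. It plays the part of the evaluation
    of quadratic Gauss sums: it bounds every representation number. *)
Lemma sum_dev_sq A W : A^T = A ->
  \sum_t (q * cnt A W t - q ^+ \rank W) ^+ 2 =
  (q - 1) * q ^+ (\rank W).+1 * rad A W.
Proof.
move=> sA.
under eq_bigr do rewrite sqrrB exprMn.
rewrite big_split sumrB /= -mulr_sumr.
have -> : \sum_t q * cnt A W t * q ^+ \rank W *+ 2 = 2 * q * q ^+ \rank W * q ^+ \rank W.
  rewrite -[X in _ = _ * X](sum_cnt A W) [RHS]mulr_sumr.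
  by apply: eq_bigr => t _; ring.
rewrite sumr_const (_ : #|@predT F| = #|F|) // -[_ *+ #|F|]mulr_natr -/(qcard R F).
rewrite [q ^+ 2]expr2 -mulrA sum_cnt_sq //.
by rewrite [in RHS]exprS; ring.
Qed.

Lemma rad_nondeg A W : A^T = A -> nondeg A W -> rad A W = 1.
Proof.
move=> sA nW; rewrite /rad (bigD1 0) ?sub0mx //= trmx0 !mulmx0 eqxx big1 ?addr0 //.
move=> u /andP[uW u0]; case: mulmx_bil0 => // h; case/eqP: u0.
by apply: nW => // w' wW'; rewrite bilC // h.
Qed.

Lemma rad_full A : A^T = A -> rad A 1%:M = q ^+ \rank (kermx A).
Proof.
move=> sA; rewrite -sum1_sub /rad.
rewrite [LHS](eq_bigl xpredT) => [|u]; last exact: submx1.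
rewrite [RHS]big_mkcond /=; apply: eq_bigr => u _.
have -> : (u <= kermx A)%MS = (1%:M *m (A *m u^T) == 0).
  rewrite mul1mx -{2}sA -trmx_mul -(inj_eq trmx_inj) trmxK trmx0.
  exact/sub_kermxP/eqP.
by case: (_ == 0).
Qed.

(** On a u + b v + w the form is 2 b(u, v) a b plus its value at w. For a != 0
    it runs over F as b does, whatever w is; for a = 0 it ignores b. *)
Lemma cnt_add_plane A W u v t : A^T = A ->
  qf A u = 0 -> qf A v = 0 -> bil A u v != 0 ->
  (forall w, (w <= W)%MS -> bil A w u = 0 /\ bil A w v = 0) ->
  cnt A (u + (v + W)%MS)%MS t = (q - 1) * q ^+ \rank W + q * cnt A W t /\
  \rank (u + (v + W)%MS)%MS = (\rank W).+2.
Proof.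
move=> sA qu qv buv hW; have two0 := two_neq0 q_odd.
have vW : ~~ (v <= W)%MS.
  by apply: contraNN buv => /hW[h _]; rewrite bilC // h.
have uvW : ~~ (u <= v + W)%MS.
  apply: contraNN buv => /addsmx_rowP[c /hW[_]].
  by rewrite !bilE -/(qf A v) qv mulr0 subr0 => ->.
have splitsum h : \sum_(w | (w <= u + (v + W))%MS) h w =
    \sum_a \sum_b \sum_(w | (w <= W)%MS) h (a *: u + (b *: v + w)) :> R.
  by rewrite sum_sub_adds //; apply: eq_bigr => a _; rewrite sum_sub_adds.
split; last first.
  apply/eqP; rewrite -(eqr_nat R) -subr_eq0 => //.
  have : q ^+ \rank (u + (v + W)%MS)%MS = q ^+ (\rank W).+2.
    rewrite -sum1_sub splitsum; under eq_bigr do under eq_bigr do rewrite sum1_sub.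
    rewrite !sumr_const (_ : #|@predT F| = #|F|) // -[_ *+ #|F| *+ #|F|]mulr_natr -/(qcard R F).
    rewrite -[_ *+ #|F|]mulr_natr -/(qcard R F).
    by move: (\rank W) => r; rewrite !exprS; ring.
  rewrite /qcard -!natrX => /eqP; rewrite eqr_nat eqn_exp2l; last exact: card_finRing_gt1.
  by move=> /eqP->; rewrite subrr.
have qw a b w : (w <= W)%MS -> qf A (a *: u + (b *: v + w)) = 2 * bil A u v * a * b + qf A w.
  move=> /hW[h1 h2]; rewrite /qf !bilE (bilC u w) // (bilC v w) // h1 h2.
  by rewrite (bilC v u) // -!/(qf A _) qu qv; ring.
rewrite /cnt splitsum (bigD1 0) //= addrC; congr (_ + _).
  transitivity (\sum_(a : F | a != 0) q ^+ \rank W); last first.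
    by rewrite sumr_const cardC1 -mulr_natl -subn1 natrB // ltnW // card_finRing_gt1.
  apply: eq_bigr => a a0; rewrite exchange_big /= -sum1_sub; apply: eq_bigr => w wW.
  have k0 : 2 * bil A u v * a != 0 by rewrite !mulf_neq0.
  rewrite -[RHS](sum_ind1 R ((t - qf A w) / (2 * bil A u v * a))).
  apply: eq_bigr => b _; rewrite qw //; congr (nat_of_bool _)%:R.
  by rewrite -[RHS](inj_eq (mulIf k0)) mulfVK // subr_eq eq_sym [b * _]mulrC.
transitivity (\sum_(b : F) cnt A W t); last by rewrite sumr_const -mulr_natl.
apply: eq_bigr => b _; apply: eq_bigr => w wW.
by rewrite qw // mulr0 mul0r add0r.
Qed.

End Counting.

(** * Quadratic forms of even rank *)

Section Hyperbolic.
Variables (R : realFieldType) (F : finFieldType) (N : nat).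
Hypothesis q_odd : odd #|F|.
Variables (A : 'M[F]_N) (sA : A^T = A).
Implicit Types (s t a b c : F) (W : 'M[F]_N) (x y u v w : 'rV[F]_N).

Local Notation q := (qcard R F).

(** The representation numbers of a nondegenerate form of rank 2m and sign eps
    (1 for hyperbolic, -1 for elliptic), multiplied by q so that no q^(m-1)
    appears when m = 0. *)
Definition even_counts (eps : R) m W :=
  forall t, q * cnt R A W t = q ^+ m.*2 - eps * q ^+ m + (t == 0)%:R * (eps * q ^+ m.+1).

(** The pairs are indexed by nat rather than by an ordinal so that a system can
    be extended by setting its value at k. The constant 1/2 makes the polar
    form, which is 2 b, equal to 1 on each pair. *)
Definition hyperbolic_system k (u v : nat -> 'rV[F]_N) :=
  forall i j, (i < k)%N -> (j < k)%N ->
   [/\ bil A (u i) (u j) = 0, bil A (v i) (v j) = 0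
     & bil A (u i) (v j) = (i == j)%:R / 2].

Lemma eq_cnt W1 W2 t : (W1 :=: W2)%MS -> cnt R A W1 t = cnt R A W2 t.
Proof. by move=> h; apply: eq_bigl => w; rewrite h. Qed.

Lemma even_counts_add_plane eps m W u v :
  qf A u = 0 -> qf A v = 0 -> bil A u v != 0 ->
  (forall w, (w <= W)%MS -> bil A w u = 0 /\ bil A w v = 0) ->
  \rank W = m.*2 -> even_counts eps m W ->
  even_counts eps m.+1 (u + (v + W)%MS)%MS /\ \rank (u + (v + W)%MS)%MS = m.+1.*2.
Proof.
move=> qu qv buv hW rW cW; split=> [t|]; have [hc hr] := cnt_add_plane R q_odd 0 sA qu qv buv hW.
  have [-> _] := cnt_add_plane R q_odd t sA qu qv buv hW.
  by rewrite mulrDr cW rW doubleS !exprS; ring.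
by rewrite hr rW.
Qed.

Lemma even_counts0 : even_counts 1 0 (0 : 'M_N).
Proof.
move=> t; rewrite /cnt (big_pred1 0) => [|w]; last exact: submx0.
by rewrite /qf bil0l eq_sym !expr0 !expr1; ring.
Qed.

Lemma half_neq0 : (2^-1 : F) != 0.
Proof. by rewrite invr_eq0 two_neq0. Qed.

Lemma hyperbolic_system_span k (u v : nat -> 'rV[F]_N) : hyperbolic_system k u v ->
  even_counts 1 k (\sum_(i < k) (u i + v i)%MS)%MS /\
  \rank (\sum_(i < k) (u i + v i)%MS)%MS = k.*2.
Proof.
elim: k => [|k IH] huv; first by rewrite big_ord0 mxrank0; split=> //; apply: even_counts0.
have {IH}[|IHc IHr] := IH; first by move=> i j ik jk; apply: huv; exact: ltnW.
set W := (\sum_(i < k) _)%MS in IHc IHr *.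
have kk : (k < k.+1)%N by [].
have [uu vv uv] := huv _ _ kk kk.
have hW w : (w <= W)%MS -> bil A w (u k) = 0 /\ bil A w (v k) = 0.
  move=> wW; split; move: w wW; apply/mulmx_bil0/eqP/sub_kermxP;
    apply/sumsmx_subP => i _; have ik : (i < k.+1)%N by rewrite ltnS ltnW.
    have [h1 h2 h3] := huv _ _ ik kk; have [h1' h2' h3'] := huv _ _ kk ik.
    rewrite addsmx_sub !orthP h1 eqxx bilC // h3'.
    by rewrite gtn_eqF // mul0r eqxx.
  have [h1 h2 h3] := huv _ _ ik kk.
  by rewrite addsmx_sub !orthP h2 eqxx h3 ltn_eqF // mul0r eqxx.
have E : (\sum_(i < k.+1) (u i + v i) :=: u k + (v k + W))%MS.
  by rewrite big_ord_recr /= -/W addsmxC addsmxA.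
have buv : bil A (u k) (v k) != 0 by rewrite uv eqxx mul1r half_neq0.
have [h1 h2] := even_counts_add_plane uu vv buv hW IHr IHc.
by split=> [t|]; rewrite ?(eq_cnt _ E) ?E.
Qed.

Lemma nondeg_exists W u : nondeg A W -> (u <= W)%MS -> u != 0 ->
  exists2 w, (w <= W)%MS & bil A u w != 0.
Proof.
move=> nW uW u0; have : W *m (A *m u^T) != 0.
  apply: contraNN u0 => /mulmx_bil0 h; apply/eqP; apply: nW => // w wW.
  by rewrite bilC // h.
rewrite row_mulmx_bil => /forallPn[i hi]; exists (row i W); first exact: row_sub.
by rewrite bilC.
Qed.

(** The plane spanned by u and a partner v is nondegenerate, so W is its
    orthogonal sum with W', the part of W orthogonal to both. *)
Lemma split_plane W u : nondeg A W -> (u <= W)%MS -> u != 0 -> qf A u = 0 ->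
  exists v (W' : 'M_N),
   [/\ qf A v = 0, bil A u v = 2^-1, nondeg A W',
       forall w, (w <= W')%MS -> bil A w u = 0 /\ bil A w v = 0
     & (W :=: u + (v + W'))%MS].
Proof.
move=> nW uW u0 qu; have two0 := two_neq0 q_odd.
have [w wW b0] := nondeg_exists nW uW u0.
have [v [vW qv buv]] := isotropic_partner sA two0 uW wW qu b0.
pose W' := (W :&: orth A u :&: orth A v)%MS.
have W'P x : (x <= W')%MS = [&& (x <= W)%MS, bil A x u == 0 & bil A x v == 0].
  by rewrite !sub_capmx !orthP andbA.
have E : (W :=: u + (v + W'))%MS.
  apply/eqmxP; rewrite !addsmx_sub uW vW /=; apply/andP; split; last first.
    by apply/row_subP => i; have := row_sub i W'; rewrite W'P => /and3P[].
  apply/row_subP => i; apply/addsmx_rowP; exists (2 * bil A (row i W) v).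
  apply/addsmx_rowP; exists (2 * bil A (row i W) u).
  rewrite W'P; set x := row i W; apply/and3P; split.
  - by rewrite !addmx_sub ?row_sub // eqmx_opp scalemx_sub.
  - by rewrite !bilE -/(qf A u) qu (bilC v u sA) buv; apply/eqP; field.
  by rewrite !bilE -/(qf A v) qv buv; apply/eqP; field.
have oW' x : (x <= W')%MS -> bil A x u = 0 /\ bil A x v = 0.
  by rewrite W'P => /and3P[_ /eqP-> /eqP->].
exists v, W'; split=> // x xW' hx; have [xu xv] := oW' _ xW'.
apply: nW => [|w']; first by move: xW'; rewrite W'P => /andP[].
rewrite E => /addsmx_rowP[a /addsmx_rowP[b /hx]].
by rewrite !bilE xu xv !mulr0 !subr0.
Qed.

Lemma sum_neq0 (h : F -> R) : \sum_(t | t != 0) h t = \sum_t h t - h 0.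
Proof. by rewrite [in RHS](bigD1 0) //= addrAC subrr add0r. Qed.

(** Splitting off planes reduces to an anisotropic form. The second moment
    leaves no anisotropic form of rank 4 or more, and in rank 2 it determines
    all representation numbers from the single zero: the sign is then -1. *)
Lemma even_rank_counts m W : nondeg A W -> \rank W = m.*2 ->
  even_counts 1 m W /\ (exists u v : nat -> 'rV[F]_N,
     hyperbolic_system m u v /\ forall i, (i < m)%N -> (u i <= W)%MS /\ (v i <= W)%MS)
  \/ even_counts (-1) m W.
Proof.
have q2 := q_gt2 R q_odd.
elim: m W => [|m IH] W nW rW.
  left; split; last by exists (fun=> 0), (fun=> 0).
  have /eqP -> : W == 0 by rewrite -mxrank_eq0 rW.
  exact: even_counts0.
have [/existsP[u /and3P[uW u0 /eqP qu]]|/existsPn aniso] :=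
  boolP [exists u, [&& (u <= W)%MS, u != 0 & qf A u == 0]].
  have [v [W' [qv buv nW' oW' E]]] := split_plane nW uW u0 qu.
  have buv0 : bil A u v != 0 by rewrite buv half_neq0.
  have rW' : \rank W' = m.*2.
    have [_] := cnt_add_plane R q_odd 0 sA qu qv buv0 oW'.
    by rewrite -E rW => -[].
  have W'W : (W' <= W)%MS.
    by rewrite E (submx_trans (addsmxSr v W')) // addsmxSr.
  have vW : (v <= W)%MS.
    by rewrite E (submx_trans (addsmxSl v W')) // addsmxSr.
  case: (IH _ nW' rW') => [[c [u' [v' [huv huvW]]]]|c];
     have [c' _] := even_counts_add_plane qu qv buv0 oW' rW' c; [left|right]; last first.
    by move=> t; rewrite (eq_cnt t E).
  split; first by move=> t; rewrite (eq_cnt t E).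
  exists (fun i => if i == m then u else u' i), (fun i => if i == m then v else v' i).
  split; last first.
    move=> i; rewrite ltnS leq_eqVlt; case: (eqVneq i m) => //= _ /huvW[h1 h2].
    by split; apply: submx_trans W'W.
  move=> i j; rewrite !ltnS [(i <= m)%N]leq_eqVlt [(j <= m)%N]leq_eqVlt.
  case: (eqVneq i m) => [->|im] /=; case: (eqVneq j m) => [->|jm] //= hi hj.
  - by rewrite mul1r; split.
  - have [/oW'[h1 h2] /oW'[h3 h4]] := huvW _ hj.
    rewrite (bilC u) // h1 (bilC v) // h4 (bilC u) // h3 mul0r.
    by split.
  - have [/oW'[h1 h2] /oW'[h3 h4]] := huvW _ hi.
    by rewrite h1 h4 h2 (negbTE im) mul0r; split.
  exact: huv.
right; have c0 : cnt R A W 0 = 1.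
  rewrite /cnt (bigD1 0) ?sub0mx //= /qf bil0l eqxx big1 ?addr0 // => w /andP[wW w0].
  by have := aniso w; rewrite wW w0 /= => /negbTE ->.
have := sum_dev_sq R q_odd W sA; rewrite rad_nondeg // mulr1 => dev.
have := sum_cnt R A W => tot.
have rW2 : m = 0%N.
  case: m {IH} rW => // m rW; exfalso.
  have : (q * cnt R A W 0 - q ^+ \rank W) ^+ 2 <= (q - 1) * q ^+ (\rank W).+1.
    rewrite -dev (bigD1 0) //= lerDl; apply: sumr_ge0 => t _; exact: sqr_ge0.
  rewrite c0 rW mulr1 (_ : m.+2.*2 = 4 + m.*2)%N // -addSn !exprD; set y := q ^+ m.*2.
  have y1 : 1 <= y by rewrite exprn_ege1 //; lra.
  (* divided by q^2 the inequality reads (1 - z)^2 <= (q - 1) z with z = q^3 y *)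
  have qy : 2 <= q * y by nra.
  have qqy : 4 <= q * (q * y) by nra.
  have z1 : q + 1 <= q * (q * (q * y)) by nra.
  apply/negP; rewrite -ltNge -subr_gt0; set z := q * (q * (q * y)) in z1 *.
  have -> : (q - q ^+ 4 * y) ^+ 2 - (q - 1) * (q ^+ 5 * y) = q ^+ 2 * (z * (z - (q + 1)) + 1).
    by rewrite /z; ring.
  by apply: mulr_gt0; [nra | nra].
rewrite {}rW2 in rW *.
rewrite rW /= in dev tot.
(* each nonzero value is taken exactly q + 1 times: the sum of the squared
   deviations from q + 1 is zero *)
have dev2 : \sum_(t | t != 0) (cnt R A W t - (q + 1)) ^+ 2 = 0.
  have dev' : \sum_(t | t != 0) (q * cnt R A W t - q ^+ 2) ^+ 2 = q ^+ 2 * (q - 1).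
    by rewrite sum_neq0 dev c0; ring.
  have tot' : \sum_(t | t != 0) cnt R A W t = q ^+ 2 - 1 by rewrite sum_neq0 tot c0.
  transitivity (\sum_(t | t != 0) (q ^- 2 * (q * cnt R A W t - q ^+ 2) ^+ 2
     - 2 * cnt R A W t + (2 * q + 1))).
    by apply: eq_bigr => t _; field; lra.
  rewrite big_split sumrB /= -!mulr_sumr dev' tot' sumr_const cardC1.
  have -> : (2 * q + 1) *+ #|F|.-1 = (2 * q + 1) * (q - 1).
    by rewrite -mulr_natr -subn1 natrB // ltnW // card_finRing_gt1.
  by field; lra.
move=> t; have [->|t0] := eqVneq t 0.
  by rewrite c0 -[1.*2]/2%N mul1r; ring.
have /eqP := psumr_eq0P (fun t _ => sqr_ge0 _) dev2 t0.
by rewrite sqrf_eq0 subr_eq0 => /eqP->; rewrite -[1.*2]/2%N mul0r; ring.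
Qed.

End Hyperbolic.

(** * External and internal points *)

Section External.
Variables (R : realFieldType) (F : finFieldType) (N : nat).
Hypothesis q_odd : odd #|F|.
Variables (A : 'M[F]_N) (sA : A^T = A).
Variables (f : {mpoly F[N]}) (fA : forall x, evalv f x = qf A x).
Implicit Types (s t a b c : F) (W : 'M[F]_N) (x y w : 'rV[F]_N).

Local Notation q := (qcard R F).

Lemma polar_bil x y : polar f x y = 2 * bil A x y.
Proof. by rewrite /polar !fA qfD //; ring. Qed.

Lemma bil_half x y c : (polar f x y == c) = (bil A x y == c / 2).
Proof.
have two0 := two_neq0 q_odd.
by rewrite polar_bil -[RHS](inj_eq (mulfI two0)) mulrCA divff // mulr1.
Qed.

Lemma hyperbolic_planeP U :
  reflect (exists u v, [/\ qf A u = 0, qf A v = 0, bil A u v = 2^-1,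
     \rank U = 2 & (U :=: u + v)%MS]) (hyperbolic_plane f U).
Proof.
apply: (iffP existsP) => [[u /existsP[v]]|[u [v [qu qv buv rU E]]]].
  rewrite !fA bil_half div1r => /and5P[/eqP qu /eqP qv /eqP buv /eqP rU /eqmxP E].
  by exists u, v.
exists u; apply/existsP; exists v; rewrite !fA bil_half div1r qu qv buv rU !eqxx /=.
exact/eqmxP.
Qed.

Lemma orthogonal_spacesP U W :
  reflect (forall u w, (u <= U)%MS -> (w <= W)%MS -> bil A u w = 0) (orthogonal_spaces f U W).
Proof.
apply: (iffP forallP) => [h u w uU wW|h u].
  have /forallP/(_ w) := h u.
  by rewrite uU wW bil_half mul0r => /eqP.
apply/forallP => w; apply/implyP => /andP[uU wW].
by rewrite bil_half h // mul0r.
Qed.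

Lemma hyperbolic_counts W : hyperbolic f W ->
  even_counts A (1 : R) (\rank W)./2 W /\ \rank W = (\rank W)./2.*2.
Proof.
move=> /existsP[U /and4P[/forallP hU /forallP oU _ /eqmxP E]].
set k := (\rank W)./2 in U hU oU E *.
have /fin_all_exists[u /fin_all_exists[v huv]] := fun i => hyperbolic_planeP _ (hU i).
pose ext (h : 'I_k -> 'rV[F]_N) i := if insub i is Some j then h j else 0.
have extE h (i : 'I_k) : ext h i = h i by rewrite /ext valK.
have sys : hyperbolic_system A k (ext u) (ext v).
  move=> i j ik jk; rewrite -[i]/(val (Ordinal ik)) -[j]/(val (Ordinal jk)) !extE.
  move: (Ordinal ik) (Ordinal jk) => {ik jk} {}i {}j.
  have [qui qvi bi _ Ei] := huv i; have [_ _ _ _ Ej] := huv j.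
  have [->|ij] := eqVneq i j.
    have [quj qvj bj _ _] := huv j.
    by rewrite eqxx mul1r; split.
  have /orthogonal_spacesP h : orthogonal_spaces f (U i) (U j).
    by have /forallP/(_ j) := oU i; rewrite ij.
  rewrite (negbTE (ij : val i != val j)) mul0r.
  by split; apply: h; rewrite ?Ei ?Ej ?addsmxSl ?addsmxSr.
have [c r] := hyperbolic_system_span R q_odd sA sys.
have E' : (\sum_(i < k) (ext u i + ext v i) :=: W)%MS.
  apply: eqmx_trans E; apply: eqmx_sums => i _; rewrite !extE; apply: eqmx_sym.
  by have [_ _ _ _] := huv i.
by split=> [t|]; [rewrite -(eq_cnt R A t E') c | rewrite -E' r].
Qed.

Lemma hyperbolic_of_system W k (u v : nat -> 'rV[F]_N) : \rank W = k.*2 ->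
  hyperbolic_system A k u v ->
  (forall i, (i < k)%N -> (u i <= W)%MS /\ (v i <= W)%MS) -> hyperbolic f W.
Proof.
move=> rW sys uvW; have [_ rS] := hyperbolic_system_span R q_odd sA sys.
have ek : (\rank W)./2 = k by rewrite rW doubleK.
rewrite /hyperbolic ek.
have buv0 i : (i < k)%N -> bil A (u i) (v i) != 0.
  by move=> ik; have [_ _ ->] := sys _ _ ik ik; rewrite eqxx mul1r half_neq0.
have rk2 i : (i < k)%N -> \rank (u i + v i)%MS = 2.
  move=> ik; have [uu vv uv] := sys _ _ ik ik.
  have [|_] := cnt_add_plane R q_odd 0 sA uu vv (buv0 _ ik) (W := 0).
    by move=> w; rewrite submx0 => /eqP->; rewrite !bil0l.
  by rewrite (adds_eqmx (eqmx_refl (u i)) (addsmx0 N (v i))) mxrank0.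
pose U := [ffun i : 'I_k => (u i + v i)%MS].
have UE : (\sum_i U i = \sum_(i < k) (u i + v i))%MS.
  by apply: eq_bigr => i _; rewrite ffunE.
apply/existsP; exists U.
apply/and4P; split.
- apply/forallP => i; rewrite ffunE; apply/hyperbolic_planeP; exists (u i), (v i).
  have [uu vv uv] := sys _ _ (ltn_ord i) (ltn_ord i).
  by rewrite uv eqxx mul1r rk2.
- apply/forallP => i; apply/forallP => j; apply/implyP => ij; rewrite !ffunE.
  apply/orthogonal_spacesP => x y.
  have [uu vv uv] := sys _ _ (ltn_ord i) (ltn_ord j).
  have [_ _ vu] := sys _ _ (ltn_ord j) (ltn_ord i).
  rewrite (negbTE (ij : val i != val j)) mul0r in uv.
  rewrite eq_sym (negbTE (ij : val i != val j)) mul0r in vu.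
  move=> /sub_addsmxP[[a b] /= ->] /sub_addsmxP[[c d] /= ->].
  rewrite [a]mx11_scalar [b]mx11_scalar [c]mx11_scalar [d]mx11_scalar !mul_scalar_mx.
  by rewrite !bilE uu vv uv (bilC (v i)) // vu; ring.
- rewrite mxdirectE /= UE rS; apply/eqP.
  by rewrite (eq_bigr (fun=> 2)) ?sum_nat_const ?card_ord ?muln2 // => i _; rewrite ffunE rk2.
have S : (\sum_(i < k) (u i + v i) <= W)%MS.
  apply/sumsmx_subP => i _; have [h1 h2] := uvW _ (ltn_ord i).
  by rewrite addsmx_sub h1 h2.
by rewrite UE -(mxrank_leqif_eq S) rS rW.
Qed.

(** The two signs give different numbers of zeros, so the dichotomy of
    even_rank_counts decides hyperbolicity. *)
Lemma hyperbolic_nondeg_counts m W : nondeg A W -> \rank W = m.*2 ->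
  even_counts A (if hyperbolic f W then 1 else -1 : R) m W.
Proof.
move=> nW rW; have [[c [u [v [sys uvW]]]]|c] := even_rank_counts R q_odd sA nW rW.
  by rewrite (hyperbolic_of_system rW sys uvW).
case: ifP => // /hyperbolic_counts[]; rewrite rW doubleK => c' _; exfalso.
have := c 0; rewrite c' eqxx mul1r !mul1r exprS => e.
have q2 := q_gt2 R q_odd; have qm : 0 < q ^+ m by rewrite exprn_gt0 // (q_gt0 R q_odd).
by clear rW; nra.
Qed.

Lemma perp_orth x : (perp f x :=: orth A x)%MS.
Proof.
apply/eqmxP/andP; split.
  apply/sumsmx_subP => y; rewrite bil_half mul0r => h.
  by rewrite genmxE orthP bilC.
apply/row_subP => i; have := row_sub i (orth A x); rewrite orthP => h.
apply: (submx_trans _ (sumsmx_sup (row i (orth A x)) _ (submx_refl _))).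
  by rewrite genmxE.
by rewrite bil_half mul0r bilC.
Qed.

Section OddDimension.
Variables (m : nat) (Nm : N = m.*2.+1).
Hypothesis nA : nondeg A 1%:M.

Lemma perp_nondeg x : qf A x != 0 ->
  [/\ nondeg A (perp f x), \rank (perp f x) = m.*2,
      ~~ (x <= perp f x)%MS & (1%:M :=: x + perp f x)%MS].
Proof.
move=> qx; have P w : (w <= perp f x)%MS = (bil A w x == 0) by rewrite perp_orth orthP.
have full w : (w <= x + perp f x)%MS.
  apply/addsmx_rowP; exists (bil A w x / qf A x); rewrite P !bilE -/(qf A x).
  by rewrite mulfVK // subrr.
split; last first.
- by apply/eqmxP; rewrite submx1 andbT; apply/row_subP.
- by rewrite P.
- apply/succn_inj; rewrite -Nm perp_orth -[in LHS](cap1mx (orth A x)) -addn1.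
  rewrite -[RHS](@mxrank1 F) -(rank_orth A 1%:M x); congr (_ + _)%N.
  case: eqP => // h; case/eqP: qx; rewrite /qf /bil -mulmxA.
  by rewrite mul1mx in h; rewrite h mulmx0 mxE.
move=> w wW hw; apply: nA => [|w' _]; first exact: submx1.
have /addsmx_rowP[c /hw] := full w'.
by rewrite P in wW; rewrite !bilE (eqP wW) mulr0 subr0.
Qed.

(** The whole space is the orthogonal sum of the line through x and of its
    polar, so its counts are those of the even-rank form on the polar at
    t - a^2 f(x), summed over a. The left side does not depend on x: this forces
    the sign of the polar to be a constant times chi (f x). *)
Lemma odd_rank_counts x t : qf A x != 0 ->
  cnt R A 1%:M t = q ^+ m.*2 +
    (if hyperbolic f (perp f x) then 1 else -1) * q ^+ m * chi R (qf A x * t).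
Proof.
move=> qx; have [nW rW xW E] := perp_nondeg qx.
have := hyperbolic_nondeg_counts nW rW; set eps := if _ then _ else _ => c.
have q0 : q != 0 by rewrite lt0r_neq0 // q_gt0.
apply: (mulfI q0); rewrite (eq_cnt R A t E) /cnt sum_sub_adds //.
have step a : q * \sum_(w | (w <= perp f x)%MS) (qf A (a *: x + w) == t)%:R =
    q ^+ m.*2 - eps * q ^+ m + ((qf A x * a) ^+ 2 == qf A x * t)%:R * (eps * q ^+ m.+1).
  have -> : ((qf A x * a) ^+ 2 == qf A x * t) = (t - a ^+ 2 * qf A x == 0).
    by rewrite subr_eq0 -[RHS](inj_eq (mulfI qx)) [RHS]eq_sym; congr (_ == _); ring.
  rewrite -c; congr (_ * _); apply: eq_bigr => w.
  rewrite perp_orth orthP => /eqP wx; congr (nat_of_bool _)%:R.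
  rewrite qfD // qfZ bilZl (bilC x w) // wx !mulr0 addr0.
  by rewrite [RHS]eq_sym subr_eq addrC eq_sym.
rewrite mulr_sumr (eq_bigr _ (fun a _ => step a)) big_split /= sumr_const -mulr_suml.
have -> : \sum_a ((qf A x * a) ^+ 2 == qf A x * t)%:R = 1 + chi R (qf A x * t).
  rewrite -(card_sqrt R q_odd) [RHS](reindex_inj (mulfI qx)) //=.
rewrite (_ : #|@predT F| = #|F|) // -[_ *+ #|F|]mulr_natr -/(qcard R F) exprS; ring.
Qed.

Lemma exists_anisotropic : exists x, qf A x != 0.
Proof.
apply/existsP; apply: contraT => /existsPn h.
have h0 x : qf A x = 0 by apply/eqP; have := h x; rewrite negbK.
have : (1 : F) == 0; last by rewrite oner_eq0.
have N0 : (0 < N)%N by rewrite Nm.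
have : delta_mx 0 (Ordinal N0) = 0 :> 'rV[F]_N.
  apply: nA => [|y _]; first exact: submx1.
  set x := delta_mx _ _; have := qfD x y sA; rewrite !h0 addr0 add0r => /esym/eqP.
  by rewrite mulf_eq0 (negbTE (two_neq0 q_odd)) => /eqP.
by move=> /matrixP/(_ 0 (Ordinal N0)); rewrite !mxE !eqxx => /eqP.
Qed.

(** Whether x is external depends only on the quadratic character of f(x), up
    to one sign attached to the form. *)
Lemma external_chi : exists delta : R,
  [/\ delta = 1 \/ delta = -1, cnt R A 1%:M 0 = q ^+ m.*2,
    forall x, (external f x)%:R = (chi R (qf A x) ^+ 2 + delta * chi R (qf A x)) / 2
  & forall x, (internal f x)%:R = (chi R (qf A x) ^+ 2 - delta * chi R (qf A x)) / 2].
Proof.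
have q2 := q_gt2 R q_odd; have qm : 0 < q ^+ m by rewrite exprn_gt0 // (q_gt0 R q_odd).
have [x0 qx0] := exists_anisotropic.
have c0 := odd_rank_counts 0 qx0.
pose delta := (cnt R A 1%:M 1 - q ^+ m.*2) / q ^+ m.
have hd x : qf A x != 0 ->
  delta * chi R (qf A x) = if hyperbolic f (perp f x) then 1 else -1.
  move=> qx; rewrite /delta (odd_rank_counts 1 qx) mulr1.
  set e := if _ then _ else _.
  set y := chi R _; transitivity (e * y ^+ 2); last by rewrite chi_sqr qx mulr1.
  by field; rewrite lt0r_neq0.
have ne x : qf A x != 0 -> x != 0.
  by apply: contraNneq => ->; rewrite /qf bil0l.
exists delta; split.
- have := hd _ qx0; have [->|->] := chi_pm1 R qx0; case: ifP => _; rewrite ?mulr1 ?mulrN1 => h;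
  by [left | right | right; rewrite -h opprK | left; rewrite -[delta]opprK h opprK].
- by rewrite c0 mulr0 chi0 mulr0 addr0.
- move=> x; rewrite /external fA; have [->|qx] := eqVneq (qf A x) 0.
    by rewrite andbF chi0 expr0n mulr0 ?addr0 ?subr0 mul0r.
  by rewrite ne // chi_sqr qx hd //=; case: ifP => _ /=; field.
move=> x; rewrite /internal fA; have [->|qx] := eqVneq (qf A x) 0.
  by rewrite andbF chi0 expr0n mulr0 ?addr0 ?subr0 mul0r.
by rewrite ne // chi_sqr qx hd // /elliptic; case: ifP => _ /=; field.
Qed.

End OddDimension.
End External.

(** * Character sums over a pencil of quadratic forms *)

Section SumBounds.
Variables (R : rcfType) (F : finFieldType) (N : nat).
Hypothesis q_odd : odd #|F|.
Implicit Types (A : 'M[F]_N) (x : 'rV[F]_N).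

Local Notation q := (qcard R F).
Local Notation s := (Num.sqrt q).

Lemma sqrt_q_sq : s ^+ 2 = q.
Proof. by rewrite sqr_sqrtr // ler0n. Qed.

Lemma sqrt_q_ge1 : 1 <= s.
Proof.
have q1 : 1 <= q by apply/ltW/(lt_trans _ (q_gt2 R q_odd)); rewrite ltr1n.
by rewrite -[leLHS]sqrtr1 ler_sqrt // (le_trans ler01 q1).
Qed.

Lemma sqrt_q_gt0 : 0 < s.
Proof. by rewrite sqrtr_gt0 q_gt0. Qed.

Lemma qpow_sqrt r : q ^+ r = (s ^+ r) ^+ 2.
Proof. by rewrite -{1}sqrt_q_sq -!exprM mulnC. Qed.

Lemma cauchy_schwarz (a b : F -> R) : 0 < \sum_t a t ^+ 2 ->
  (\sum_t a t * b t) ^+ 2 <= (\sum_t a t ^+ 2) * \sum_t b t ^+ 2.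
Proof.
set X := \sum_t a t ^+ 2; set Y := \sum_t b t ^+ 2; set T := \sum_t _ => X0.
rewrite -subr_ge0 -(pmulr_rge0 _ X0).
have -> : X * (X * Y - T ^+ 2) = \sum_t (X * b t - T * a t) ^+ 2; last first.
  by apply: sumr_ge0 => t _; apply: sqr_ge0.
rewrite [RHS](eq_bigr (fun t => X ^+ 2 * b t ^+ 2 - 2 * X * T * (a t * b t) + T ^+ 2 * a t ^+ 2)).
  by rewrite big_split sumrB /= -!mulr_sumr -/X -/Y -/T; ring.
by move=> t _; ring.
Qed.

Lemma sum_full (h : 'rV[F]_N -> R) : \sum_(x | (x <= (1%:M : 'M_N))%MS) h x = \sum_x h x.
Proof. by apply: eq_bigl => x; rewrite submx1. Qed.

Variables (A : 'M[F]_N) (sA : A^T = A).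
Local Notation e := (\rank (kermx A)).

Lemma dev_full : \sum_t (q * cnt R A 1%:M t - q ^+ N) ^+ 2 = (q - 1) * q ^+ (N.+1 + e).
Proof.
by have := sum_dev_sq R q_odd 1%:M sA; rewrite mxrank1 rad_full // -mulrA -exprD.
Qed.

(** The deviation at 0 is one term of the second moment; the corank e of the
    form costs a factor s^e. *)
Lemma zero_count_dev : `|q * cnt R A 1%:M 0 - q ^+ N| <= s ^+ (N.+2 + e).
Proof.
have q0 := q_gt0 R q_odd.
rewrite -(ler_pXn2r (ltn0Sn 1)) ?nnegrE ?exprn_ge0 ?sqrtr_ge0 //.
rewrite real_normK ?num_real // -qpow_sqrt.
apply: (@le_trans _ _ ((q - 1) * q ^+ (N.+1 + e))).
  by rewrite -dev_full (bigD1 0) //= lerDl; apply: sumr_ge0 => t _; apply: sqr_ge0.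
by rewrite [N.+2]lock addSn -lock addSn [leRHS]exprS ler_pM2r ?exprn_gt0 // lerBlDr lerDl ler01.
Qed.

(** Cauchy-Schwarz against the second moment; chi has mean zero, so only the
    deviations of the representation numbers matter. *)
Lemma chi_sum_bound : `|\sum_x chi R (qf A x)| * q <= (q - 1) * s ^+ (N.+1 + e).
Proof.
have q0 := q_gt0 R q_odd; have q1 := q_sub1_gt0 R q_odd.
have sumchi2 : \sum_(t : F) chi R t ^+ 2 = q - 1.
  under eq_bigr do rewrite chi_sqr.
  rewrite (bigD1 0) //= eqxx add0r (eq_bigr (fun=> 1)) => [|t ->] //.
  by rewrite sumr_const cardC1 -subn1 natrB // ltnW // card_finRing_gt1.
rewrite -(ler_pXn2r (ltn0Sn 1)) ?nnegrE ?mulr_ge0 ?exprn_ge0 ?(ltW q0) ?(ltW q1) ?sqrtr_ge0 ?normr_ge0 //.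
rewrite !exprMn real_normK ?num_real // -qpow_sqrt -exprMn.
have -> : (\sum_x chi R (qf A x)) * q = \sum_t chi R t * (q * cnt R A 1%:M t - q ^+ N).
  rewrite -sum_full -sum_cnt_mul.
  under [RHS]eq_bigr do rewrite mulrBr.
  rewrite sumrB -mulr_suml sum_chi // mul0r subr0 mulr_suml.
  by apply: eq_bigr => t _; ring.
apply: le_trans (cauchy_schwarz _ _) _; rewrite sumchi2 //.
by rewrite dev_full expr2 mulrA.
Qed.

End SumBounds.

Section Pencil.
Variables (R : rcfType) (F : finFieldType) (n : nat).
Hypothesis q_odd : odd #|F|.
Local Notation q := (qcard R F).
Local Notation s := (Num.sqrt q).
Local Notation N := n.+1.
Local Notation V := (1%:M : 'M[F]_N).
Variables (A1 A2 : 'M[F]_N) (sA1 : A1^T = A1) (sA2 : A2^T = A2).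
Hypothesis A1_unit : A1 \in unitmx.
Local Notation B l := (A2 - l *: A1).
Local Notation corank l := (\rank (kermx (B l))).
Local Notation f1 := (qf A1).
Local Notation f2 := (qf A2).
Implicit Types (l : F) (x : 'rV[F]_N).

(** The degenerate members of the pencil are the eigenvalues of A1^-1 A2. *)
Lemma degenerate_card : (\sum_l (corank l != 0) <= N)%N.
Proof.
pose g := invmx A1 *m A2.
have h l : corank l != 0%N -> root (char_poly g) l.
  rewrite mxrank_eq0 -eigenvalue_root_char => /rowV0Pn[v /sub_kermxP hv v0].
  apply/eigenvalueP; exists (v *m A1).
    rewrite /g mulmxA mulmxK //; apply/eqP; rewrite -subr_eq0 scalemxAr -mulmxBr.
    exact/eqP.
  by apply: contraNneq v0 => h; rewrite -(mulmxK A1_unit v) h mul0mx.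
have -> : (\sum_l (corank l != 0) = size (enum [set l | corank l != 0%N]))%N.
  rewrite -cardE -sum1dep_card [RHS]big_mkcond /=.
  by apply: eq_bigr => l _; case: eqP.
rewrite -ltnS -(size_char_poly g); apply: max_poly_roots.
- by rewrite -size_poly_gt0 size_char_poly.
- by apply/allP => l; rewrite mem_enum inE => /h.
exact: enum_uniq.
Qed.

Variable k : nat.
Hypothesis corank_le : forall l, (corank l <= k.+1)%N.
Hypothesis nondeg_count : forall l, corank l = 0%N -> cnt R (B l) V 0 = q ^+ n.

Local Notation D := (s ^+ (n + k)).

Lemma pencil_sym l : (B l)^T = B l.
Proof. by rewrite linearB linearZ /= sA1 sA2. Qed.

Lemma D_gt0 : 0 < D. Proof. by rewrite exprn_gt0 // sqrt_q_gt0. Qed.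

(** The nondegenerate members have exactly the average number of zeros, because
    the number of variables is odd: only the degenerate ones contribute. *)
Lemma count_dev l : `|cnt R (B l) V 0 - q ^+ n| <= (corank l != 0)%N%:R * (q * D).
Proof.
have q0 := q_gt0 R q_odd; have s1 := sqrt_q_ge1 R q_odd.
case: eqP => [/nondeg_count->|_] /=; first by rewrite subrr normr0 mul0r.
rewrite mul1r -(ler_pM2l q0) -[X in X * `|_|]gtr0_norm // -normrM mulrBr -exprS.
apply: le_trans (zero_count_dev R q_odd (pencil_sym l)) _ => //.
have -> : q * (q * D) = s ^+ (N.+2 + k.+1).
  rewrite -{1 2}(sqrt_q_sq R F) -!exprD; congr (_ ^+ _); lia.
by rewrite ler_weXn2l // leq_add2l.
Qed.

Lemma sum_count_dev (g : F -> R) : (forall l, `|g l| <= 1) ->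
  `|\sum_l g l * (cnt R (B l) V 0 - q ^+ n)| <= N%:R * (q * D).
Proof.
move=> g1; apply: le_trans (ler_norm_sum _ _ _) _.
apply: (@le_trans _ _ (\sum_l (corank l != 0)%N%:R * (q * D))).
  apply: ler_sum => l _; rewrite normrM -[leRHS]mul1r ler_pM ?normr_ge0 //.
  exact: count_dev.
rewrite -mulr_suml ler_wpM2r ?mulr_ge0 ?(ltW D_gt0) ?(ltW (q_gt0 R q_odd)) // -natr_sum ler_nat.
exact: degenerate_card.
Qed.

Lemma pencil_solve x l : f1 x != 0 -> (qf (B l) x == 0) = (f2 x / f1 x == l).
Proof.
move=> f10; rewrite qfBA subr_eq0 -(inj_eq (mulIf (invr_neq0 f10))).
by rewrite mulfK.
Qed.

Lemma pencil_base x l : f1 x = 0 -> qf (B l) x = f2 x.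
Proof. by move=> f10; rewrite qfBA f10 mulr0 subr0. Qed.

Lemma cntE l : cnt R (B l) V 0 = \sum_x (qf (B l) x == 0)%:R.
Proof. by rewrite /cnt sum_full. Qed.

(** Where f1 does not vanish, chi (f1) chi (f2) = chi (f2 / f1), and f2 / f1 = l
    means that x lies on the member f2 - l f1. The base locus lies on every
    member and is cancelled by the vanishing sum of chi, as is the average q^n. *)
Lemma sum_chi_mul : \sum_x chi R (f1 x) * chi R (f2 x) =
  \sum_l chi R l * (cnt R (B l) V 0 - q ^+ n).
Proof.
under [RHS]eq_bigr do rewrite mulrBr.
rewrite sumrB -mulr_suml sum_chi // mul0r subr0.
under [RHS]eq_bigr do rewrite cntE mulr_sumr.
rewrite exchange_big /=; apply: eq_bigr => x _.
have [f10|f10] := eqVneq (f1 x) 0.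
  under eq_bigr do rewrite pencil_base //.
  by rewrite -mulr_suml sum_chi // f10 chi0 !mul0r.
under eq_bigr do rewrite pencil_solve //.
rewrite sum_ind -chiM // -[RHS](chi_mulsq R _ f10); congr (chi R _).
by field.
Qed.

Lemma sum_chi_mul_bound : `|\sum_x chi R (f1 x) * chi R (f2 x)| <= N%:R * (q * D).
Proof.
rewrite sum_chi_mul; apply: sum_count_dev => l.
by have [->|/(chi_pm1 R)[]->] := eqVneq l 0; rewrite ?chi0 ?normr0 ?normrN ?normr1 ?ler01.
Qed.

(** A point lies on all q members of the pencil when it is in the base locus,
    on exactly one when f1 does not vanish, and on none otherwise. *)
Lemma sum_base_count :
  q * (\sum_x ((f1 x == 0) && (f2 x == 0))%:R) - cnt R A1 V 0
   = \sum_l 1 * (cnt R (B l) V 0 - q ^+ n).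
Proof.
under [RHS]eq_bigr do rewrite mul1r cntE.
rewrite sumrB exchange_big /= sumr_const (_ : #|@predT F| = #|F|) //.
rewrite -[_ *+ #|F|]mulr_natr -/(qcard R F).
have -> : \sum_x \sum_l (qf (B l) x == 0)%:R =
   \sum_x (1 - (f1 x == 0)%:R + q * ((f1 x == 0) && (f2 x == 0))%:R) :> R.
  apply: eq_bigr => x _; have [f10|f10] := eqVneq (f1 x) 0 => /=.
    under eq_bigr do rewrite pencil_base //.
    by rewrite sumr_const -mulr_natl -/(qcard R F); ring.
  under eq_bigr do rewrite pencil_solve //.
  by rewrite sum_ind1; ring.
rewrite big_split /= -mulr_sumr sumrB /cnt !sum_full.
have -> : \sum_(x : 'rV[F]_N) 1 = q ^+ N :> R by rewrite -sum_full sum1_sub mxrank1.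
by rewrite [q ^+ N]exprSr; ring.
Qed.

Lemma sum_base_count_bound : cnt R A1 V 0 = q ^+ n ->
  `|q * (\sum_x ((f1 x == 0) && (f2 x == 0))%:R) - q ^+ n| <= N%:R * (q * D).
Proof.
move=> c1; have := sum_base_count; rewrite c1 => ->.
by apply: sum_count_dev => l; rewrite normr1.
Qed.

(** Where f1 does not vanish, f2 - l f1 runs over F with l and the characters
    cancel; where it vanishes, all members agree with f2. *)
Lemma sum_chi_base : q * (\sum_x (f1 x == 0)%:R * chi R (f2 x)) =
  \sum_l \sum_x chi R (qf (B l) x).
Proof.
rewrite exchange_big mulr_sumr /=; apply: eq_bigr => x _.
have [f10|f10] := eqVneq (f1 x) 0.
  under [RHS]eq_bigr do rewrite pencil_base //.
  by rewrite sumr_const mul1r -[RHS]mulr_natl.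
under [RHS]eq_bigr do rewrite qfBA.
have inj : injective (fun l => f2 x - l * f1 x) by move=> l l' /addrI/oppr_inj/(mulIf f10).
by rewrite mul0r mulr0 -[LHS](sum_chi R q_odd) [LHS](reindex_inj inj).
Qed.

Lemma chi_pencil_bound l : `|\sum_x chi R (qf (B l) x)| <=
   (q - 1) * (D + (corank l != 0)%N%:R * (s * D)).
Proof.
have q0 := q_gt0 R q_odd; have s1 := sqrt_q_ge1 R q_odd; have s0 := sqrt_q_gt0 R q_odd.
have q1 := q_sub1_gt0 R q_odd.
rewrite -(ler_pM2r q0); apply: le_trans (chi_sum_bound R q_odd (pencil_sym l)) _.
rewrite -mulrA ler_pM2l //.
case: eqP => [->|_] /=.
  rewrite mul0r addr0 addn0 -[X in _ <= _ * X](sqrt_q_sq R F) -exprD ler_weXn2l //; lia.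
rewrite mul1r; apply: (@le_trans _ _ (s * D * q)).
  rewrite -[X in _ <= _ * X](sqrt_q_sq R F) -exprS -exprD ler_weXn2l //.
  by have := corank_le l; lia.
by rewrite ler_pM2r // lerDr ltW ?D_gt0.
Qed.

Lemma sum_chi_base_bound :
  `|\sum_x (f1 x == 0)%:R * chi R (f2 x)| <= (q - 1) * (N.+1%:R * D).
Proof.
have q0 := q_gt0 R q_odd; have s1 := sqrt_q_ge1 R q_odd; have s0 := sqrt_q_gt0 R q_odd.
have q1 := q_sub1_gt0 R q_odd.
rewrite -(ler_pM2l q0) -[X in X * `|_|]gtr0_norm // -normrM sum_chi_base.
apply: le_trans (ler_norm_sum _ _ _) _.
apply: (@le_trans _ _ (\sum_l (q - 1) * (D + (corank l != 0)%N%:R * (s * D)))).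
  by apply: ler_sum => l _; apply: chi_pencil_bound.
rewrite -mulr_sumr mulrCA ler_pM2l // big_split /=.
have -> : \sum_(l : F) D = q * D by rewrite sumr_const -mulr_natl.
rewrite -mulr_suml -natr_sum -[N.+1%:R]natr1 mulrDl mul1r mulrDr addrC lerD2r.
apply: (@le_trans _ _ (N%:R * (s * D))).
  rewrite ler_wpM2r ?mulr_ge0 ?(ltW D_gt0) ?(ltW s0) // ler_nat.
  exact: degenerate_card.
rewrite [leRHS]mulrCA ler_wpM2l // ler_wpM2r ?(ltW D_gt0) //.
by rewrite -[leRHS](sqrt_q_sq R F) expr2 ler_peMr // ltW.
Qed.

End Pencil.

(** * Counting external-internal points *)

(** The error terms of the six sums, collected. Here P is the number of
    projective points, Q stands for q^(n-1) and D for s^(n + sigma + 1). Some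
    bounds lack the factor q - 1 that is lost in passing to projective points;
    q <= 2 (q - 1) makes up for it. *)
Lemma error_terms (R : realFieldType) (q Q D N P Z X X1 X2 Y1 Y2 d1 d2 : R) :
  2 < q -> 0 <= N -> 0 <= D -> d1 = 1 \/ d1 = -1 -> d2 = 1 \/ d2 = -1 ->
  `|X| <= N * (q * D) -> `|q * Z - q * Q| <= N * (q * D) ->
  `|Y2| <= (q - 1) * ((N + 1) * D) -> `|Y1| <= (q - 1) * ((N + 1) * D) ->
  `|X1| <= (q - 1) * D -> `|X2| <= (q - 1) * D ->
  4 * ((q - 1) * P) = q * (q * Q) - q * Q - q * Q + Z + d1 * (X1 - Y1)
                      - d2 * (X2 - Y2) - d1 * d2 * X ->
  `|P - (q * Q - Q) / 4| <= (5 * N + 4) / 4 * D.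
Proof.
move=> q2 N0 D0 hd1 hd2 hX; rewrite -mulrBr normrM gtr0_norm; last by lra.
rewrite mulrCA ler_pM2l; last by lra.
move=> hZ hY2 hY1 hX1 hX2 card.
have T0 : 0 <= N * D by rewrite mulr_ge0.
have qT : 0 <= (q - 2) * (N * D) by rewrite mulr_ge0 // subr_ge0 ltW.
have q1 : 0 < 4 * (q - 1) by lra.
rewrite -(ler_pM2l q1) -[X in X * `|_|]gtr0_norm // -normrM.
have -> : 4 * (q - 1) * (P - (q * Q - Q) / 4) =
  Z - Q + d1 * (X1 - Y1) - d2 * (X2 - Y2) - d1 * d2 * X.
  transitivity (4 * ((q - 1) * P) - (q - 1) * (q * Q - Q)); first by field.
  by rewrite card; ring.
move: hX hZ hY2 hY1 hX1 hX2; rewrite !ler_norml => /andP[a1 a2] /andP[b1 b2].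
move=> /andP[c1 c2] /andP[e1 e2] /andP[g1 g2] /andP[h1 h2].
by case: hd1 => ->; case: hd2 => ->; apply/andP; split; clear card; lra.
Qed.

Section PointCount.
Variables (R : rcfType) (F : finFieldType) (m k : nat).
Hypothesis q_odd : odd #|F|.
Local Notation q := (qcard R F).
Local Notation s := (Num.sqrt q).
Local Notation n := (m.+1.*2).
Local Notation N := n.+1.
Local Notation V := (1%:M : 'M[F]_N).
Local Notation D := (s ^+ (n + k)).
Implicit Types (A : 'M[F]_N) (f : {mpoly F[N]}) (x : 'rV[F]_N).

Lemma nondeg_corank0 A : A^T = A -> \rank (kermx A) = 0%N <-> nondeg A V.
Proof.
move=> sA; split=> [/eqP|nA].
  rewrite mxrank_eq0 => /eqP kA w _ hw; apply/eqP; rewrite -submx0 -kA.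
  by apply/sub_kermxP/bil_eq0 => y; apply: hw; apply: submx1.
apply/eqP; rewrite mxrank_eq0 -submx0; apply/row_subP => i.
have /sub_kermxP := row_sub i (kermx A); set v := row i _ => hv.
suff -> : v = 0 by apply: sub0mx.
by apply: nA => [|w _]; rewrite ?submx1 // /bil hv mul0mx mxE.
Qed.

Lemma nondeg_unit A : A^T = A -> nondeg A V -> A \in unitmx.
Proof.
by move=> sA /(nondeg_corank0 sA)/eqP; rewrite mxrank_eq0 kermx_eq0 row_free_unit.
Qed.

Lemma nondeg_zero_count A f : A^T = A -> (forall x, evalv f x = qf A x) ->
  \rank (kermx A) = 0%N -> cnt R A V 0 = q ^+ n.
Proof.
move=> sA fA /(nondeg_corank0 sA) nA.
by have [d []] := external_chi R q_odd sA fA (erefl : N = m.+1.*2.+1) nA.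
Qed.

(** Every line in the set carries q - 1 nonzero vectors. *)
Lemma external_internal_points_card (f1 f2 : {mpoly F[N]}) :
  (forall c x, c != 0 -> external f1 (c *: x) && internal f2 (c *: x) =
                         external f1 x && internal f2 x) ->
  \sum_x (external f1 x && internal f2 x)%:R = (q - 1) * #|external_internal_points f1 f2|%:R.
Proof.
move=> stable; set S := fun x => external f1 x && internal f2 x.
have S0 x : S x -> x != 0 by rewrite /S => /andP[/and3P[]].
transitivity (\sum_(x | x \in [pred x | S x]) (1 : R)).
  by rewrite [RHS]big_mkcond; apply: eq_bigr => x _; rewrite inE /S; case: (_ && _).
have -> : external_internal_points f1 f2 = [set <<x>>%MS | x in [pred x | S x]].
  by apply/setP => p; apply/imsetP/imsetP => -[x Sx ->]; exists x => //; move: Sx; rewrite !inE.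
rewrite (partition_big_imset (fun x : 'rV[F]_N => <<x>>%MS)) /=.
transitivity (\sum_(p in [set <<x>>%MS | x in [pred x | S x]]) (q - 1)); last first.
  by rewrite sumr_const mulr_natr.
apply: eq_bigr => _ /imsetP[x0 Sx0 ->]; rewrite inE in Sx0.
transitivity (\sum_(x : 'rV[F]_N | (x <= <<x0>>)%MS && (x != 0)) (1 : R)); last first.
  have := sum1_sub R <<x0>>%MS; rewrite (bigD1 0) ?sub0mx //= genmxE rank_rV S0 // expr1.
  by move=> <-; rewrite addrAC subrr add0r.
apply: eq_bigl => x; rewrite inE; apply/andP/andP => [[Sx /eqP/genmxP/andP[h _]]|[]].
  by rewrite genmxE h S0.
rewrite genmxE => /sub_rVP[c ->] cx0.
have c0 : c != 0 by apply: contraNneq cx0 => ->; rewrite scale0r.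
split; first by rewrite /S stable.
by apply/eqP/genmxP/andP; rewrite !(eqmx_scale _ c0) submx_refl.
Qed.

Variables (A1 A2 : 'M[F]_N) (sA1 : A1^T = A1) (sA2 : A2^T = A2).
Variables (f1 f2 : {mpoly F[N]}).
Hypotheses (fA1 : forall x, evalv f1 x = qf A1 x) (fA2 : forall x, evalv f2 x = qf A2 x).
Hypotheses (nA1 : nondeg A1 V) (nA2 : nondeg A2 V).
Hypothesis corank_le : forall l, (\rank (kermx (A2 - l *: A1)) <= k.+1)%N.

(** A1 - l A2 is proportional to A2 - l^-1 A1, and A1 itself is nondegenerate. *)
Lemma corank_swap l : (\rank (kermx (A1 - l *: A2)) <= k.+1)%N.
Proof.
have [->|l0] := eqVneq l 0.
  by rewrite scale0r subr0 (iffRL (nondeg_corank0 sA1)).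
rewrite (leq_trans _ (corank_le l^-1)) // !mxrank_ker leq_sub2l // leq_eqVlt; apply/orP; left.
have -> : A1 - l *: A2 = (- l) *: (A2 - l^-1 *: A1).
  by rewrite scalerBr scalerA mulNr divff // scaleN1r opprK addrC scaleNr.
by rewrite eqmx_scale // oppr_eq0.
Qed.

Lemma pencil_nondeg_count A1' A2' g1 g2 : A1'^T = A1' -> A2'^T = A2' ->
  (forall x, evalv g1 x = qf A1' x) -> (forall x, evalv g2 x = qf A2' x) ->
  forall l, \rank (kermx (A2' - l *: A1')) = 0%N -> cnt R (A2' - l *: A1') V 0 = q ^+ n.
Proof.
move=> s1 s2 e1 e2 l; apply: (nondeg_zero_count (f := g2 - l *: g1)).
  by rewrite linearB linearZ /= s1 s2.
by move=> x; rewrite qfBA -e1 -e2 /evalv mevalB mevalZ.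
Qed.

Lemma chi_sum_nondeg A : A^T = A -> nondeg A V ->
  `|\sum_x chi R (qf A x)| <= (q - 1) * D.
Proof.
move=> sA nA; have q0 := q_gt0 R q_odd; have s1 := sqrt_q_ge1 R q_odd.
have q1 := q_sub1_gt0 R q_odd.
rewrite -(ler_pM2r q0); apply: le_trans (chi_sum_bound R q_odd sA) _.
rewrite (iffRL (nondeg_corank0 sA)) // -mulrA ler_pM2l //.
by rewrite -[X in _ <= _ * X](sqrt_q_sq R F) -exprD ler_weXn2l //; lia.
Qed.

(** Expanding the product of the two indicators in chi (f1) and chi (f2) leads
    to the sums bounded above; the main term comes from the count of the
    points off both quadrics. *)
Lemma point_count : `|#|external_internal_points f1 f2|%:R - (q ^+ n - q ^+ n.-1) / 4| <=
  (5 * N%:R + 4) / 4 * D.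
Proof.
have q2 := q_gt2 R q_odd; have q0 := q_gt0 R q_odd.
have [d1 [hd1 c1 E1 _]] := external_chi R q_odd sA1 fA1 (erefl : N = m.+1.*2.+1) nA1.
have [d2 [hd2 c2 _ E2]] := external_chi R q_odd sA2 fA2 (erefl : N = m.+1.*2.+1) nA2.
set x1 := fun x => chi R (qf A1 x); set x2 := fun x => chi R (qf A2 x).
have EI x : (external f1 x && internal f2 x)%:R =
    (x1 x ^+ 2 + d1 * x1 x) / 2 * ((x2 x ^+ 2 - d2 * x2 x) / 2).
  by rewrite -E1 -E2 -natrM mulnb.
have card : 4 * ((q - 1) * #|external_internal_points f1 f2|%:R) =
    \sum_x x1 x ^+ 2 * x2 x ^+ 2 + d1 * \sum_x x1 x * x2 x ^+ 2
    - d2 * \sum_x x1 x ^+ 2 * x2 x - d1 * d2 * \sum_x x1 x * x2 x.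
  rewrite -external_internal_points_card => [|c x c0]; last first.
    have inj (a b : bool) : a%:R = b%:R :> R -> a = b.
      by case: a; case: b => // /eqP; rewrite ?oner_eq0 // eq_sym oner_eq0.
    by apply: inj; rewrite !EI /x1 /x2 !qfZ !chi_mulsq.
  by rewrite !mulr_sumr -!big_split -!sumrB /=; apply: eq_bigr => x _; rewrite EI; field.
have u1 := nondeg_unit sA1 nA1; have u2 := nondeg_unit sA2 nA2.
have N12 := pencil_nondeg_count sA1 sA2 fA1 fA2.
have N21 := pencil_nondeg_count sA2 sA1 fA2 fA1.
have b11 := sum_chi_mul_bound q_odd sA1 sA2 u1 corank_le N12.
have b0 := sum_base_count_bound q_odd sA1 sA2 u1 corank_le N12 c1.
have b12 := sum_chi_base_bound R q_odd sA1 sA2 u1 corank_le.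
have b21 := sum_chi_base_bound R q_odd sA2 sA1 u2 corank_swap.
have g1 := chi_sum_nondeg sA1 nA1; have g2 := chi_sum_nondeg sA2 nA2.
have full0 : \sum_(x : 'rV[F]_N) 1 = q ^+ N :> R.
  by rewrite -(sum_full (fun=> 1)) sum1_sub mxrank1.
have full1 : \sum_x (qf A1 x == 0)%:R = q ^+ n :> R by rewrite -c1 /cnt sum_full.
have full2 : \sum_x (qf A2 x == 0)%:R = q ^+ n :> R by rewrite -c2 /cnt sum_full.
have sq1 y : x1 y ^+ 2 = 1 - (qf A1 y == 0)%:R.
  by rewrite /x1 chi_sqr; case: eqP; rewrite ?subr0 ?subrr.
have sq2 y : x2 y ^+ 2 = 1 - (qf A2 y == 0)%:R.
  by rewrite /x2 chi_sqr; case: eqP; rewrite ?subr0 ?subrr.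
have T22 : \sum_x x1 x ^+ 2 * x2 x ^+ 2 =
    q ^+ N - q ^+ n - q ^+ n + \sum_x ((qf A1 x == 0) && (qf A2 x == 0))%:R.
  rewrite -full0 -{1}full1 -full2 -!sumrB -big_split /=.
  by apply: eq_bigr => x _; rewrite sq1 sq2 -mulnb natrM; ring.
have T12 : \sum_x x1 x * x2 x ^+ 2 =
    \sum_x x1 x - \sum_x (qf A2 x == 0)%:R * x1 x.
  by rewrite -sumrB; apply: eq_bigr => x _; rewrite sq2; ring.
have T21 : \sum_x x1 x ^+ 2 * x2 x =
    \sum_x x2 x - \sum_x (qf A1 x == 0)%:R * x2 x.
  by rewrite -sumrB; apply: eq_bigr => x _; rewrite sq1; ring.
move: b11 b0 b12 b21 g1 g2 card; rewrite T12 T21 T22 -/x1 -/x2.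
set P := #|_|%:R; set Z := \sum_x ((qf A1 x == 0) && _)%:R.
set X11 := \sum_x x1 x * x2 x; set X1 := \sum_x x1 x; set X2 := \sum_x x2 x.
set Y1 := \sum_x (qf A2 x == 0)%:R * x1 x; set Y2 := \sum_x (qf A1 x == 0)%:R * x2 x.
have qN : q ^+ N = q * (q * q ^+ n.-1) by rewrite -!exprS.
have qn : q ^+ n = q * q ^+ n.-1 by rewrite -exprS.
rewrite qN qn -[n.+2%:R]natr1.
apply: (error_terms q2 _ _ hd1 hd2); first exact: ler0n.
by rewrite exprn_ge0 // sqrtr_ge0.
Qed.

End PointCount.

(** * Irreducible closed sets swept out by polynomial curves *)

Section Closure.
Variables (K : closedFieldType) (N : nat).
Implicit Types (S : 'rV[K]_N -> Prop) (x y : 'rV[K]_N) (g : 'I_N -> {poly K}).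

(** Only homogeneous polynomials are tested, so this is the punctured cone over
    the closure of the image of S in projective space. *)
Definition zariski_closure S x :=
  x != 0 /\ forall d (p : {mpoly K[N]}), p \is d.-homog ->
    (forall y, S y -> evalv p y = 0) -> evalv p x = 0.

Lemma zariski_closure_closed S : zariski_closed (zariski_closure S).
Proof.
exists (fun p => (exists d, p \is d.-homog) /\ forall y, S y -> evalv p y = 0).
split=> [p []//|x]; split=> -[x0 h]; split=> //.
  by move=> p [[d pd]]; apply: h pd.
by move=> d p pd pS; apply: h; split=> //; exists d.
Qed.

Lemma sub_zariski_closure S y : S y -> y != 0 -> zariski_closure S y.
Proof. by move=> Sy y0; split=> // d p _; apply. Qed.

Lemma zariski_closureS S T : (forall y, S y -> T y) ->
  Defs.subsetP (zariski_closure S) (zariski_closure T).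
Proof.
by move=> ST x [x0 h]; split=> // d p pd pT; apply: h pd _ => y /ST; apply: pT.
Qed.

Lemma closure_sub_closed S Z : zariski_closed Z -> (forall y, S y -> Z y) ->
  Defs.subsetP (zariski_closure S) Z.
Proof.
move=> [I [Ihom IZ]] SZ x [x0 h]; apply/IZ; split=> // p Ip.
have [d pd] := Ihom p Ip; apply: h pd _ => y /SZ/IZ[_]; exact.
Qed.

Definition curve_point g (t : K) : 'rV[K]_N := \row_j (g j).[t].

Lemma evalv_curve (p : {mpoly K[N]}) g t :
  evalv p (curve_point g t) = (mmap polyC g p).[t].
Proof.
rewrite /evalv /meval /mmap horner_sum; apply: eq_bigr => m _.
rewrite hornerM hornerC; congr (_ * _).
rewrite /mmap1 horner_prod; apply: eq_bigr => i _.
by rewrite horner_exp mxE.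
Qed.

Definition curve_connected S := forall a b, S a -> S b ->
  exists g, [/\ curve_point g 0 = a, curve_point g 1 = b & forall t, S (curve_point g t)].

(** If the closure were covered by two closed sets, neither containing S, there
    would be polynomials p and r, vanishing on the first and on the second set,
    with p(a) and r(b) nonzero for some a and b in S. Along a polynomial curve
    from a to b inside S the product p r is a nonzero polynomial in one variable,
    so it does not vanish at some point of S. *)
Lemma curve_connected_irreducible S : (exists y, S y) ->
  (forall y, S y -> y != 0) -> curve_connected S ->
  zariski_irreducible (zariski_closure S).
Proof.
move=> [y0 Sy0] S0 cS; split; first by exists y0; apply: sub_zariski_closure (S0 _ _).
move=> A B cA cB AB.
have [SA|/existsNP[a /not_implyP[Sa nAa]]] := pselect (forall y, S y -> A y).
  by left; apply: closure_sub_closed.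
have [SB|/existsNP[b /not_implyP[Sb nBb]]] := pselect (forall y, S y -> B y).
  by right; apply: closure_sub_closed.
exfalso; have [g [ga gb gS]] := cS a b Sa Sb.
have miss Z z : zariski_closed Z -> z != 0 -> ~ Z z -> exists2 p : {mpoly K[N]},
    evalv p z != 0 & forall y, Z y -> evalv p y = 0.
  move=> [I [_ IZ]] z0 nZ; apply: contrapT => h; apply: nZ; apply/IZ; split=> // p Ip.
  apply: contrapT => /eqP pz; apply: h; exists p => // y /IZ[_]; exact.
have [p pa pA] := miss A a cA (S0 _ Sa) nAa.
have [r rb rB] := miss B b cB (S0 _ Sb) nBb.
have : mmap polyC g p * mmap polyC g r != 0.
  rewrite mulf_neq0 //; first by apply: contraNneq pa => h; rewrite -ga evalv_curve h horner0.
  by apply: contraNneq rb => h; rewrite -gb evalv_curve h horner0.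
move=> /closed_nonrootP[t]; rewrite /root hornerM -!evalv_curve.
have : zariski_closure S (curve_point g t) by apply: sub_zariski_closure (S0 _ _).
by case/AB => [/pA->|/rB->]; rewrite ?mul0r ?mulr0 eqxx.
Qed.

End Closure.

(** * Quadratic forms as polynomials *)

Section QuadraticPolynomials.
Variables (K : fieldType) (N : nat).
Implicit Types (A : 'M[K]_N) (x : 'rV[K]_N).

Definition quad_poly A : {mpoly K[N]} := \sum_i \sum_j A i j *: ('X_i * 'X_j).

Lemma quad_poly_homog A : quad_poly A \is 2.-homog.
Proof.
apply: rpred_sum => i _; apply: rpred_sum => j _; apply: rpredZ.
by rewrite -mpolyXD dhomogX /= mdegD !mdeg1.
Qed.

Lemma quad_polyD A1 A2 : quad_poly (A1 + A2) = quad_poly A1 + quad_poly A2.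
Proof.
rewrite /quad_poly -big_split /=; apply: eq_bigr => i _; rewrite -big_split /=.
by apply: eq_bigr => j _; rewrite mxE scalerDl.
Qed.

Lemma quad_polyZ a A : quad_poly (a *: A) = a *: quad_poly A.
Proof.
rewrite /quad_poly scaler_sumr; apply: eq_bigr => i _; rewrite scaler_sumr.
by apply: eq_bigr => j _; rewrite mxE scalerA.
Qed.

Lemma quad_poly_tr A : quad_poly A^T = quad_poly A.
Proof.
rewrite /quad_poly exchange_big; apply: eq_bigr => i _; apply: eq_bigr => j _.
by rewrite mxE mulrC.
Qed.

Lemma evalv_quad A x : evalv (quad_poly A) x = qf A x.
Proof.
rewrite /evalv /quad_poly /qf /bil raddf_sum mxE.
under [RHS]eq_bigr do rewrite mxE mulr_suml.
rewrite exchange_big /=; apply: eq_bigr => i _; rewrite raddf_sum; apply: eq_bigr => j _.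
by rewrite /= mevalZ mevalM !mevalXU !mxE; ring.
Qed.

Lemma evalv_deriv_quad A x j :
  evalv ((quad_poly A)^`M(j)) x = (x *m (A + A^T)) 0 j.
Proof.
rewrite /evalv /quad_poly (raddf_sum (mderiv j)) (raddf_sum (meval _)) /=.
have dX (i : 'I_N) : ('X_i : {mpoly K[N]})^`M(j) = (i == j)%:R.
  rewrite mderivX mnm1E; case: eqP => [->|_]; last by rewrite scale0r.
  rewrite (_ : (U_(j) - U_(j))%MM = 0%MM) ?mpolyX0 ?scale1r //.
  by apply/mnmP => k; rewrite mnmBE subnn mnm0E.
transitivity (\sum_i \sum_k A i k * ((i == j)%:R * x 0 k + x 0 i * (k == j)%:R)).
  apply: eq_bigr => i _; rewrite (raddf_sum (mderiv j)) (raddf_sum (meval _)); apply: eq_bigr => k _.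
  by rewrite /= mderivZ mderivM !dX mevalZ mevalD !mevalM !mevalXU !rmorph_nat.
under eq_bigr do under eq_bigr do rewrite mulrDr.
under eq_bigr do rewrite big_split.
rewrite big_split mulmxDr !mxE [RHS]addrC /=; congr (_ + _).
  rewrite (bigD1 j) //= [X in _ + X]big1 ?addr0.
    by apply: eq_bigr => k _; rewrite eqxx mul1r mulrC !mxE.
  by move=> i /negbTE ij; rewrite big1 // => k _; rewrite ij mul0r mulr0.
rewrite exchange_big (bigD1 j) //= [X in _ + X]big1 ?addr0.
  by apply: eq_bigr => k _; rewrite eqxx mulr1 mulrC.
by move=> i /negbTE ij; rewrite big1 // => k _; rewrite ij !mulr0.
Qed.

(** Every monomial of degree 2 is a product of two variables. *)
Lemma homog2_quad (f : {mpoly K[N]}) : f \is 2.-homog -> exists A, f = quad_poly A.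
Proof.
move=> /dhomogP hf; rewrite (mpolyE f) big_seq; apply: (big_ind (fun p => exists A, p = quad_poly A)).
- by exists 0; rewrite -[0 in RHS](scale0r 0) quad_polyZ scale0r.
- by move=> _ _ [A1 ->] [A2 ->]; exists (A1 + A2); rewrite quad_polyD.
move=> m /hf /= mf.
have [i mi] : exists i, m i != 0%N.
  apply/existsP; apply: contraT => /existsPn h; move: mf; rewrite mdegE big1 // => i _.
  by apply/eqP; have := h i; rewrite negbK.
have im : (U_(i) <= m)%MM by rewrite lep1mP.
have : mdeg (m - U_(i)) == 1%N.
  by rewrite -(eqn_add2r (mdeg U_(i))) -mdegD submK // mf mdeg1.
rewrite mdeg_eq1 => /existsP[j /eqP mj].
exists (f@_m *: delta_mx i j); rewrite quad_polyZ; congr (_ *: _).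
rewrite -(submK im) mj mpolyXD /quad_poly (bigD1 i) //= (bigD1 j) //= mxE !eqxx scale1r.
rewrite [X in _ + X + _]big1 => [|k /negbTE kj]; last by rewrite mxE kj andbF scale0r.
rewrite [X in _ + X]big1 => [|k /negbTE ki].
  by rewrite !addr0 mulrC.
by rewrite big1 // => l _; rewrite mxE ki scale0r.
Qed.

Lemma homog2_sym_quad (f : {mpoly K[N]}) : (2 : K) != 0 -> f \is 2.-homog ->
  exists2 A, A^T = A & f = quad_poly A.
Proof.
move=> two0 /homog2_quad[A ->]; exists (2^-1 *: (A + A^T)).
  by rewrite linearZ linearD /= trmxK addrC.
rewrite quad_polyZ quad_polyD quad_poly_tr -[X in X + X]scale1r -scalerDl scalerA.
by rewrite -[1 + 1]/(2 : K) mulVf // scale1r.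
Qed.

End QuadraticPolynomials.

Lemma map_quad_poly (F K : fieldType) (iota : {rmorphism F -> K}) N (A : 'M[F]_N) :
  map_mpoly iota (quad_poly A) = quad_poly (map_mx iota A).
Proof.
rewrite /quad_poly rmorph_sum; apply: eq_bigr => i _; rewrite rmorph_sum.
apply: eq_bigr => j _.
by rewrite /= map_mpolyZ rmorphM /= !map_mpolyX mxE.
Qed.

(** * Dimension of the singular locus *)

Section SingularLocus.
Variables (K : closedFieldType) (N : nat).
Hypothesis two0 : (2 : K) != 0.
Implicit Types (A E L W : 'M[K]_N) (x y u v w : 'rV[K]_N).

Lemma monic_quadratic_root (b c : K) : exists t, t ^+ 2 = b * t + c.
Proof.
have [t] := @solve_monicpoly K 2 (fun i => if i == 0%N then c else b) isT.
by rewrite !big_ord_recl big_ord0 /= expr0 expr1 mulr1 addr0 addrC; exists t.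
Qed.

Definition linear_poly (C : 'cV[K]_N) : {mpoly K[N]} := \sum_i C i 0 *: 'X_i.

Lemma linear_poly_homog C : linear_poly C \is 1.-homog.
Proof. by apply: rpred_sum => i _; apply: rpredZ; rewrite dhomogX /= mdeg1. Qed.

Lemma evalv_linear C x : evalv (linear_poly C) x = (x *m C) 0 0.
Proof.
rewrite /evalv /linear_poly (raddf_sum (meval _)) mxE; apply: eq_bigr => i _.
by rewrite /= mevalZ mevalXU mulrC.
Qed.

Lemma closure_kernel (S : 'rV[K]_N -> Prop) p (C : 'M[K]_(N, p)) x :
  zariski_closure S x -> (forall y, S y -> y *m C = 0) -> x *m C = 0.
Proof.
move=> [_ h] SC; apply/rowP => j; rewrite [RHS]mxE.
have e y : (y *m C) 0 j = evalv (linear_poly (col j C)) y.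
  by rewrite evalv_linear colE mulmxA -colE [RHS]mxE.
rewrite e; apply: (h 1%N) => [|y /SC Sy]; first exact: linear_poly_homog.
by rewrite -e Sy mxE.
Qed.

(** A linear subspace is cut out by linear forms, the columns of its cokernel. *)
Lemma closure_submx (S : 'rV[K]_N -> Prop) p (U : 'M[K]_(p, N)) x :
  zariski_closure S x -> (forall y, S y -> (y <= U)%MS) -> (x <= U)%MS.
Proof.
move=> Sx SU; rewrite submxE; apply/eqP; apply: closure_kernel Sx _ => y /SU.
by rewrite submxE => /eqP.
Qed.

(** The points v - q(w) u + w, for w in L, make up a piece of the quadric of E,
    parametrised by the vector space L. The linear forms vanishing on u, v and a flag of subspaces of L tell
    the images of the subspaces apart, so their closures make a chain of length
    dim L; two points of an image are joined by the image of a line, a curve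
    whose coordinates have degree at most 2. *)

Section Chain.
Variables (A E L : 'M[K]_N) (u v : 'rV[K]_N) (d : nat).
Hypotheses (sA : A^T = A) (v0 : v != 0) (Ld : (d <= \rank L)%N).
Hypotheses (uE : (u <= E)%MS) (vE : (v <= E)%MS) (LE : (L <= E)%MS).
Hypothesis (Luv : (L :&: (u + v) = 0)%MS).
Hypothesis iso : forall w, (w <= L)%MS -> qf A (v - qf A w *: u + w) = 0.

Definition flag i : 'M[K]_(\rank L, N) := pid_mx i *m row_base L.

Lemma flag_rank i : (i <= d)%N -> \rank (flag i) = i.
Proof.
move=> id; rewrite mxrankMfree ?row_base_free // rank_pid_mx //;
exact: leq_trans id Ld.
Qed.

Lemma flag_sub i : (flag i <= L)%MS.
Proof. by rewrite /flag (submx_trans (submxMl _ _)) // eq_row_base. Qed.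

Lemma flagS i : (i < d)%N -> (flag i <= flag i.+1)%MS.
Proof.
move=> id; have e : pid_mx i = pid_mx i *m (pid_mx i.+1 : 'M_(\rank L)) :> 'M[K]_(\rank L).
  by rewrite mul_pid_mx (minn_idPl (leqnSn i)) (minn_idPr (leq_trans (ltnW id) Ld)).
by rewrite /flag e -mulmxA submxMl.
Qed.

Definition sweep i y := exists2 w, (w <= flag i)%MS & y = v - qf A w *: u + w.

Lemma sweep_neq0 i y : sweep i y -> y != 0.
Proof.
move=> [w wi ->]; apply: contraNneq v0 => e.
have w0 : w = 0.
  apply/eqP; rewrite -submx0 -Luv sub_capmx (submx_trans wi (flag_sub i)) /=.
  have -> : w = qf A w *: u - v by rewrite -[RHS]addr0 -e; apply/rowP => j; rewrite !mxE; ring.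
  by rewrite addmx_sub ?eqmx_opp ?addsmxSr // scalemx_sub // addsmxSl.
by rewrite -e w0 /qf bil0l scale0r subr0 addr0.
Qed.

Lemma sweep_curve_connected i : curve_connected (sweep i).
Proof.
move=> a b [w wi ->] [z zi ->].
pose q0 := qf A w; pose q1 := 2 * bil A w (z - w); pose q2 := qf A (z - w).
have qt t : qf A (w + t *: (z - w)) = q0 + q1 * t + q2 * t ^+ 2.
  by rewrite qfD // qfZ bilZr /q0 /q1 /q2; ring.
pose g j : {poly K} := (v 0 j)%:P - (q0%:P + q1%:P * 'X + q2%:P * 'X ^+ 2) * (u 0 j)%:P +
   ((w 0 j)%:P + (z 0 j - w 0 j)%:P * 'X).
have gt t : curve_point g t =
    v - qf A (w + t *: (z - w)) *: u + (w + t *: (z - w)).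
  by apply/rowP => j; rewrite !mxE /g !(hornerD, hornerN, hornerM, hornerC, hornerX, horner_exp) qt; ring.
exists g; split=> [||t]; rewrite gt.
- by rewrite scale0r addr0.
- by rewrite scale1r [w + _]addrC subrK.
by exists (w + t *: (z - w)); rewrite // addmx_sub // scalemx_sub // addmx_sub // eqmx_opp.
Qed.

(** A vector w of the larger subspace outside the smaller one gives a point
    outside the linear span of u, v and the smaller one, which contains the
    closure of the smaller image. *)
Lemma sweep_not_sub i : (i < d)%N ->
  ~ Defs.subsetP (zariski_closure (sweep i.+1)) (zariski_closure (sweep i)).
Proof.
move=> id sub.
have : ~~ (flag i.+1 <= flag i)%MS.
  by apply/negP => /mxrankS; rewrite !flag_rank // ?ltnn // ltnW.
move=> /row_subPn[r]; set w := row r _ => wi.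
have wL : (w <= flag i.+1)%MS by apply: row_sub.
set y := v - qf A w *: u + w.
have Sy : sweep i.+1 y by exists w.
case/negP: wi.
have uvS z : (z <= u + v -> z <= flag i + (u + v))%MS.
  by move=> h; apply: submx_trans h (addsmxSr _ _).
have h0 c : (v - c *: u <= u + v)%MS.
  by rewrite addmx_sub ?addsmxSr // eqmx_opp scalemx_sub // addsmxSl.
have yU : (y <= flag i + (u + v))%MS.
  apply: closure_submx (sub _ (sub_zariski_closure Sy (sweep_neq0 Sy))) _ => z [w' w'i ->].
  by apply: addmx_sub; [exact/uvS/h0 | exact: submx_trans w'i (addsmxSl _ _)].
have /sub_addsmxP[[a b] /= wab] : (w <= flag i + (u + v))%MS.
  have -> : w = y - (v - qf A w *: u) by rewrite /y addrAC subrr add0r.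
  by apply: addmx_sub => //; rewrite eqmx_opp; exact/uvS/h0.
suff e0 : b *m (u + v)%MS = 0 by rewrite wab e0 addr0 submxMl.
apply/eqP; rewrite -submx0 -Luv sub_capmx submxMl andbT.
have -> : b *m (u + v)%MS = w - a *m flag i by rewrite wab addrC addKr.
rewrite addmx_sub ?eqmx_opp ?(submx_trans wL (flag_sub _)) //.
exact: submx_trans (submxMl _ _) (flag_sub _).
Qed.

Lemma sweep_chain (X : 'rV[K]_N -> Prop) :
  (forall x, x != 0 -> qf A x = 0 -> (x <= E)%MS -> X x) -> irreducible_chain X d.
Proof.
move=> EX; exists (fun i => zariski_closure (sweep i)); split=> i id.
  split; first exact: zariski_closure_closed.
    apply: curve_connected_irreducible.
    - by exists (v - qf A 0 *: u + 0), 0; rewrite ?sub0mx.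
    - exact: sweep_neq0.
    exact: sweep_curve_connected.
  move=> x Sx; have [x0 h] := Sx; apply: EX => //.
    rewrite -evalv_quad; apply: (h 2); first exact: quad_poly_homog.
    move=> _ [w wi ->]; rewrite evalv_quad iso //.
    exact: submx_trans wi (flag_sub i).
  apply: closure_submx Sx _ => _ [w wi ->].
  rewrite !addmx_sub // ?eqmx_opp ?scalemx_sub //.
  exact: submx_trans (submx_trans wi (flag_sub i)) LE.
split; last exact: sweep_not_sub.
by apply: zariski_closureS => _ [w wi ->]; exists w => //; apply: submx_trans wi (flagS id).
Qed.

End Chain.

(** A quadric in the projective space of E has codimension at most one there.
    Either some isotropic u in E is not in the radical: with a partner v and L
    orthogonal to both, the points v - q(w) u + w form an affine chart of the
    quadric. Or every isotropic vector is in the radical R; over an algebraically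
    closed field R is then at least a hyperplane of E, and it is isotropic, so
    translates of a complement of v in R by a nonzero v in R serve, with u = 0. *)
Lemma quadric_chain A E (X : 'rV[K]_N -> Prop) d : A^T = A -> \rank E = d.+2 ->
  (forall x, x != 0 -> qf A x = 0 -> (x <= E)%MS -> X x) -> irreducible_chain X d.
Proof.
move=> sA rE EX.
have [[u [w [uE wE qu buw]]]|nA] :=
  pselect (exists u w, [/\ (u <= E)%MS, (w <= E)%MS, qf A u = 0 & bil A u w != 0]).
  have [v [vE qv buv]] := isotropic_partner sA two0 uE wE qu buw.
  pose L := (E :&: orth A u :&: orth A v)%MS.
  have LP x : (x <= L)%MS -> bil A x u = 0 /\ bil A x v = 0.
    by rewrite !sub_capmx !orthP => /andP[/andP[_ /eqP->] /eqP->].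
  apply: (@sweep_chain A E L u v d) => //.
  - by apply: contraNneq two0 => v0; rewrite -invr_eq0 -buv v0 bil0r.
  - have := rank_orth A E u; have := rank_orth A (E :&: orth A u)%MS v.
    by rewrite -/L; case: (_ != _); case: (_ != _); lia.
  - by rewrite /L -capmxA capmxSl.
  - apply/eqP; rewrite -submx0; apply/row_subP => i.
    have := row_sub i (L :&: (u + v))%MS; set x := row i _.
    rewrite sub_capmx => /andP[/LP[xu xv]] /sub_addsmxP[[a b] /= e].
    move: e; rewrite [a]mx11_scalar [b]mx11_scalar !mul_scalar_mx => e.
    move: xu xv; rewrite e !bilE -!/(qf A _) qu qv (bilC v u sA) buv.
    rewrite !mulr0 add0r addr0 => /eqP; rewrite mulf_eq0 invr_eq0 (negbTE two0) orbF.
    move=> /eqP -> /eqP; rewrite mulf_eq0 invr_eq0 (negbTE two0) orbF => /eqP ->.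
    by rewrite !scale0r addr0 sub0mx.
  move=> w' /LP[xu xv]; rewrite qfD // bilC // !bilE xu xv qfD // /qf !bilE -!/(qf A _).
  by rewrite qu qv (bilC v u sA) buv; field.
have bE u w : (u <= E)%MS -> (w <= E)%MS -> qf A u = 0 -> bil A u w = 0.
  by move=> uE wE qu; apply: contrapT => /eqP h; apply: nA; exists u, w.
pose R := (E :&: kermx (A *m E^T))%MS.
have RP x : (x <= R)%MS = (x <= E)%MS && (E *m (A *m x^T) == 0).
  rewrite sub_capmx; congr (_ && _); rewrite -(inj_eq trmx_inj) trmx0 !trmx_mul trmxK sA.
  by apply/sub_kermxP/eqP; rewrite -mulmxA.
have isoR x : (x <= E)%MS -> qf A x = 0 -> (x <= R)%MS.
  by move=> xE qx; rewrite RP xE /=; apply/mulmx_bil0 => w wE; rewrite bilC // bE.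
have qR x : (x <= R)%MS -> qf A x = 0.
  by rewrite RP => /andP[xE /mulmx_bil0/(_ x xE)].
have rR : (d.+1 <= \rank R)%N.
  have [[a [aE qa]]|nq] := pselect (exists a, (a <= E)%MS /\ qf A a != 0); last first.
    have ER : (E <= R)%MS.
      apply/row_subP => i; apply: isoR; rewrite ?row_sub //.
      by apply: contrapT => /eqP h; apply: nq; exists (row i E); rewrite row_sub.
    by have := mxrankS ER; rewrite rE; lia.
  have ER : (E <= a + R)%MS.
    apply/row_subP => i; apply/addsmx_rowP; set w := row i E.
    have [t ht] := monic_quadratic_root (2 * bil A w a / qf A a) (- (qf A w / qf A a)).
    exists t; apply: isoR; first by rewrite addmx_sub ?row_sub // eqmx_opp scalemx_sub.
    have {}ht : t ^+ 2 * qf A a = 2 * bil A w a * t - qf A w by rewrite ht; field.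
    rewrite qfD // /qf !bilE -!/(qf A _) mulrN.
    transitivity (qf A w - 2 * bil A w a * t + t ^+ 2 * qf A a); first by ring.
    by rewrite ht; ring.
  have := mxrankS ER; have [+ _] := mxrank_adds_leqif a R.
  by have := rank_leq_row a; rewrite rE; lia.
have /rowV0Pn[v vR v0] : R != 0 by rewrite -mxrank_eq0; lia.
have RE : (R <= E)%MS by apply: capmxSl.
apply: (@sweep_chain A E (R :\: v)%MS 0 v d) => //.
- have := mxrank_cap_compl R v; have := mxrankS (capmxSr R v).
  by have := rank_leq_row v; lia.
- exact: sub0mx.
- exact: submx_trans vR RE.
- exact: submx_trans (diffmxSl _ _) RE.
- have e : ((0 : 'rV[K]_N) + v :=: v)%MS by apply: adds0mx.
  by apply/eqP; rewrite -submx0 (cap_eqmx (eqmx_refl _) e) capmx_diff.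
move=> w /submx_trans/(_ (diffmxSl _ _)) wR; rewrite scaler0 subr0.
by apply: qR; apply: addmx_sub.
Qed.

(** On the kernel of A2 - l A1 the gradient of f2 is l times that of f1, so a
    zero of f1 there is a zero of f2, and it is singular on the intersection. *)
Lemma sing_locus_chain (A1 A2 : 'M[K]_N) l d : A1^T = A1 -> A2^T = A2 ->
  \rank (kermx (A2 - l *: A1)) = d.+2 ->
  irreducible_chain (sing_locus (quad_poly A1) (quad_poly A2)) d.
Proof.
move=> s1 s2 rk; apply: (quadric_chain s1 rk) => x x0 q1 /sub_kermxP xk.
have xA : x *m A2 = l *: (x *m A1).
  by apply/eqP; rewrite -subr_eq0 scalemxAr -mulmxBr xk.
split; [split=> //| split=> // |].
- by rewrite evalv_quad.
- by rewrite evalv_quad /qf /bil xA -scalemxAl mxE -/(bil A1 x x) -/(qf A1 x) q1 mulr0.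
set J := jacobian _ _ _.
have JE (j : 'I_2) i : J j i = (if j == 0 then 1 else l) * (2 * (x *m A1) 0 i).
  rewrite mxE; case: ifP => _; rewrite evalv_deriv_quad mulmxDr [LHS]mxE.
    by rewrite s1; ring.
  by rewrite s2 xA [(l *: (x *m A1)) 0 i]mxE; ring.
clearbody J; have JS : (J <= row 0 J)%MS.
  apply/row_subP => j; have -> : row j J = (if j == 0 then 1 else l) *: row 0 J.
    by apply/rowP => i; rewrite !mxE !JE eqxx mul1r.
  exact: scalemx_sub.
by rewrite ltnS (leq_trans (mxrankS JS)) // rank_leq_row.
Qed.

End SingularLocus.

Theorem corollary10 (R : realType) (n : nat) (n_ge2 : (2 <= n)%N) (n_even : ~~ odd n) :
  exists c : R,
  forall (F : finFieldType) (q_odd : odd #|F|)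
    (K : closedFieldType) (iota : {rmorphism F -> K}) (K_alg : integralRange iota)
    (f1 f2 : {mpoly F[n.+1]})
    (smooth_C : smooth_quadric f1) (smooth_D : smooth_quadric f2)
    (C_neq_D : ~ (forall x, quadric (map_mpoly iota f1) x <->
                            quadric (map_mpoly iota f2) x))
    (sigma : int)
    (dim_sigma : is_dim (sing_locus (map_mpoly iota f1) (map_mpoly iota f2)) sigma),
  let q : R := #|F|%:R in
  `| #|external_internal_points f1 f2|%:R - (q ^+ n - q ^+ n.-1) / 4%:R |
    <= c * Num.sqrt q ^ (n%:Z + sigma + 1).
Proof.
exists ((5 * n.+1%:R + 4) / 4).
have [m nm] : exists m, n = m.+1.*2 by exists n./2.-1; lia.
subst n; move=> F q_odd K iota _ f1 f2 [hom1 nd1] [hom2 nd2] _ sigma [sigma_ge dimP]; cbv zeta.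
have two0 := two_neq0 q_odd.
have two0K : (2 : K) != 0 by rewrite -(rmorph_nat iota 2) fmorph_eq0.
have [A1 sA1 e1] := homog2_sym_quad two0 hom1.
have [A2 sA2 e2] := homog2_sym_quad two0 hom2.
have fA1 x : evalv f1 x = qf A1 x by rewrite e1 evalv_quad.
have fA2 x : evalv f2 x = qf A2 x by rewrite e2 evalv_quad.
have nA1 : nondeg A1 1%:M.
  move=> x _ hx; apply: nd1 => y; rewrite (polar_bil sA1 fA1) hx ?mulr0 ?submx1 //.
have nA2 : nondeg A2 1%:M.
  move=> x _ hx; apply: nd2 => y; rewrite (polar_bil sA2 fA2) hx ?mulr0 ?submx1 //.
have [k hk] : exists k : nat, sigma + 1 = k%:Z.
  by exists `|(sigma + 1)%R|%N; rewrite gez0_abs // -(lerD2r (-1)) addrK add0r.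
have corank_le l : (\rank (kermx (A2 - l *: A1)) <= k.+1)%N.
  case e: (\rank _) => [|[|d]] //.
  have chain : irreducible_chain (sing_locus (map_mpoly iota f1) (map_mpoly iota f2)) d.
    rewrite e1 e2 !map_quad_poly; apply: (sing_locus_chain two0K (l := iota l)).
    - by rewrite map_trmx sA1.
    - by rewrite map_trmx sA2.
    by rewrite -map_mxZ -map_mxB -map_kermx mxrank_map.
  by have /dimP := chain; lia.
have -> : (m.+1.*2)%:Z + sigma + 1 = (m.+1.*2 + k)%N%:Z by rewrite -addrA hk.
exact: (point_count R q_odd sA1 sA2 fA1 fA2 nA1 nA2 corank_le).
Qed.
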